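(* For every $n\ge1$, the labeling $\lambda_{\mathcal{NC}}$ is an EW-labeling of the noncrossing partition lattice $\mathcal{NC}_n$. Hence $Q_{\lambda_{\mathcal{NC}}}(\mathcal{NC}_n)$ is a Whitney dual of $\mathcal{NC}_n$.
   Context: A partition of $[n]$ is noncrossing if there are no $a<b<c<d$ with $a,c$ in one block and $b,d$ in a different block. $\mathcal{NC}_n$ is the set of noncrossing partitions of $[n]$ ordered by refinement; a cover $\pi\lessdot\sigma$ merges two blocks $B_i,B_j$ of $\pi$. If $\min B_i<\min B_j$, set $\lambda_{\mathcal{NC}}(\pi\lessdot\sigma)=\max\{a\in B_i: a<\min B_j\}$, an integer (labels ordered as integers). E-labelings: words of labels of saturated chains are read bottom to top; increasing = strictly increasing; ascent-free = no consecutive labels $a<b$. ER-labeling: every closed interval has exactly one increasing maximal chain. Rank two switching property: for every saturated chain $\hat0=x_0\lessdot\cdots\lessdot x_k$ and $i$ with $\lambda(x_{i-1}\lessdot x_i)<\lambda(x_i\lessdot x_{i+1})$ there is a unique $x_i'$ with $x_{i-1}\lessdot x_i'\lessdot x_{i+1}$, $\lambda(x_{i-1}\lessdot x_i')=\lambda(x_i\lessdot x_{i+1})$, $\lambda(x_i'\lessdot x_{i+1})=\lambda(x_{i-1}\lessdot x_i)$. EW-labeling: ER-labeling with the rank two switching property such that in each interval distinct maximal chains have distinct label words. $Q_\lambda(P)$: $C(P)$ is the set of saturated chains from $\hat0$ ordered by inclusion; $\mathbf c_1\sim_\lambda\mathbf c_2$ iff they end at the same $y$ and are connected by quadratic exchanges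 (replacing $x_i$ by $x_i'$ at an ascent, forwards or backwards) among maximal chains of $[\hat0,y]$; $Q_\lambda(P)$ is the set of classes ordered by the transitive closure of: $X\le Y$ if some $\mathbf c\in X$, $\mathbf d\in Y$ have $\mathbf c\subseteq\mathbf d$. Whitney numbers: $w_k(P)=\sum_{\rho(x)=k}\mu(\hat0,x)$, $W_k(P)=|\{x:\rho(x)=k\}|$; $P,Q$ are Whitney duals if $|w_k(P)|=W_k(Q)$ and $|w_k(Q)|=W_k(P)$ for all $k$. *)

(* Defs.v *)
From mathcomp Require Import all_boot all_order all_algebra.
Set Implicit Arguments. Unset Strict Implicit. Unset Printing Implicit Defensive.
Import GRing.Theory Num.Theory.

(* Generic finite posets.  A finite poset is given by a finite carrier
   type U, a domain D : {set U} (the elements of the poset), an order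
   relation le (only its restriction to D matters) and a bottom bot.    *)
Section FinPoset.
Variables (U : finType) (D : {set U}) (le : rel U).

Definition ltP (x y : U) := (x != y) && le x y.

Definition covers (x y : U) :=
  [&& x \in D, y \in D, ltP x y & [forall z in D, ~~ (ltP x z && ltP z y)]].

Definition maxchain (x y : U) (s : seq U) := path covers x s && (last x s == y).

Variable bot : U.

Definition rank (x : U) : nat :=
  \max_(k < #|D|.+1)
     (if [exists t : (nat_of_ord k).-tuple U,
            path covers bot t && (last bot t == x)] then nat_of_ord k else 0).

Local Open Scope ring_scope.
Fixpoint mu_aux (k : nat) (x y : U) : int :=
  if x == y then 1 else
  match k with
  | 0 => 0
  | k'.+1 => if le x y then - \sum_(z in D | le x z && ltP z y) mu_aux k' x z
             else 0
  end.
Definition mobius (x y : U) : int := mu_aux #|D| x y.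

Definition whitney1 (k : nat) : int := \sum_(x in D | rank x == k) mobius bot x.
Definition whitney2 (k : nat) : nat := #|[set x in D | rank x == k]|.
Local Close Scope ring_scope.

Variable lam : U -> U -> nat.

Definition word (x : U) (s : seq U) : seq nat := pairmap lam x s.
Definition increasing (w : seq nat) := sorted ltn w.

Definition ER_labeling : Prop :=
  forall x y, x \in D -> y \in D -> le x y ->
    exists! s, maxchain x y s /\ increasing (word x s).

(* rank two switching property: for every saturated chain
   bot = x_0 <. ... <. x_k, written p ++ [:: a; b; c] ++ q with
   (a,b,c) = (x_{i-1},x_i,x_{i+1}) *)
Definition rank_two_switching : Prop :=
  forall (p q : seq U) (a b c : U),
    head a p = bot -> sorted covers (p ++ [:: a, b, c & q]) ->
    lam a b < lam b c ->
    exists! b', [/\ covers a b', covers b' c,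
                    lam a b' = lam b c & lam b' c = lam a b].

Definition EW_labeling : Prop :=
  [/\ ER_labeling, rank_two_switching &
      forall x y s1 s2, maxchain x y s1 -> maxchain x y s2 ->
        word x s1 = word x s2 -> s1 = s2].

(* a saturated chain from bot, represented by its set of elements *)
Definition chain_seq (c : {set U}) : seq U := sort le (enum c).
Definition satchain (c : {set U}) : bool :=
  [&& chain_seq c != [::], head bot (chain_seq c) == bot &
      sorted covers (chain_seq c)].
Definition chain_top (c : {set U}) : U := last bot (chain_seq c).

Definition qexch (c d : {set U}) : bool :=
  [exists a, exists b, exists e, exists b',
    [&& a \in c, b \in c, e \in c, covers a b, covers b e,
        covers a b', covers b' e, lam a b < lam b e,
        lam a b' == lam b e, lam b' e == lam a b &
        d == b' |: (c :\ b)]].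

Definition qstep (c d : {set U}) := qexch c d || qexch d c.

Definition chain_sim (c1 c2 : {set U}) : bool :=
  [&& satchain c1, satchain c2, chain_top c1 == chain_top c2 &
      connect qstep c1 c2].

Definition chain_class (c : {set U}) : {set {set U}} := [set d | chain_sim c d].

Definition Qdom : {set {set {set U}}} :=
  [set chain_class c | c in [set c : {set U} | satchain c]].

Definition Qstep (X Y : {set {set U}}) : bool :=
  [&& X \in Qdom, Y \in Qdom & [exists c in X, exists d in Y, c \subset d]].

Definition Qle : rel {set {set U}} := fun X Y => connect Qstep X Y.

Definition Qbot : {set {set U}} := chain_class [set bot].

End FinPoset.

Definition whitney_dual (U1 : finType) (D1 : {set U1}) (le1 : rel U1) (bot1 : U1)
  (U2 : finType) (D2 : {set U2}) (le2 : rel U2) (bot2 : U2) : Prop :=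
  forall k : nat,
    absz (whitney1 D1 le1 bot1 k) = whitney2 D2 le2 bot2 k /\
    absz (whitney1 D2 le2 bot2 k) = whitney2 D1 le1 bot1 k.

(* Noncrossing partitions of [n]; [n] = {1..n} is encoded by 'I_n via
   i |-> i+1 (order preserving).                                       *)
Section NC.
Variable n : nat.
Definition NCcarrier := {set {set 'I_n}}.

Definition noncrossing (P : NCcarrier) : bool :=
  [forall a : 'I_n, forall b : 'I_n, forall c : 'I_n, forall d : 'I_n,
    [&& a < b, b < c & c < d] ==>
    ~~ [exists B in P, exists B' in P,
          [&& B != B', a \in B, c \in B, b \in B' & d \in B']]].

Definition NCdom : {set NCcarrier} :=
  [set P : NCcarrier | partition P [set: 'I_n] && noncrossing P].

Definition refines : rel NCcarrier :=
  fun P Q => [forall B in P, exists B' in Q, B \subset B'].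

Definition NCbot : NCcarrier := [set [set i] | i : 'I_n].

Definition minB (B : {set 'I_n}) : nat := \big[minn/n]_(i in B) (nat_of_ord i).

(* lambda(P <. Q) = max{ a in B_i : a < min B_j } where B_i, B_j are the
   two blocks of P merged in Q (those not in Q), min B_i < min B_j;
   labels are elements of [n] = {1..n}, whence the shift a.+1 *)
Definition lamNC (P Q : NCcarrier) : nat :=
  \max_(a : 'I_n | [exists Bi, exists Bj,
        [&& Bi \in P :\: Q, Bj \in P :\: Q, minB Bi < minB Bj,
            a \in Bi & a < minB Bj]]) (nat_of_ord a).+1.
End NC.

(* Main.v *)
(** An exchange permutes the label word of a chain, and a chain is determined by
    its label word; hence a class of chains ending at [y] amounts to a multiset
    of labels and contains exactly one ascent-free chain.  So [Q] has as many
    elements of rank [k] as there are ascent-free chains of length [k], which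
    is [|w_k(P)|].  Conversely a saturated chain of [Q] starting at the bottom
    is a saturated chain of [P], and an interval [[Z, X]] of [Q] contains exactly
    one ascent-free chain, so the Moebius function of [Q] counts increasing
    chains of [P], of which there is one for each [y].  Both Moebius functions
    come from one involution: cut a label word into an increasing and an
    ascent-free part and move the element at the junction.

    For noncrossing partitions, a cover removes one element [m] from the set of
    block minima, and its label is the predecessor of [m] in the new block.  The
    chain thus attaches every lost minimum [m] to some [p m < m]; the arcs
    [p m -- m] do not cross, so [p] can be recovered from the multiset of its
    values, and [p] together with the word gives the chain.  Increasing chains
    are those in which [p m] is the predecessor of [m] in the final partition. *)
Require Import Defs.
From mathcomp Require Import all_boot all_order all_algebra.
From mathcomp Require Import zify.
Set Implicit Arguments. Unset Strict Implicit. Unset Printing Implicit Defensive.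
Import GRing.Theory Num.Theory.

(** * Counting chains in graded posets *)

Section GradedPoset.
Variables (U : finType) (D : {set U}) (le : rel U) (bot : U) (rho : U -> nat).
Local Notation cov := (covers D le).
Hypothesis bot_dom : bot \in D.
Hypothesis le_bot : forall x, x \in D -> le bot x.
Hypothesis le_refl : forall x, x \in D -> le x x.
Hypothesis rho_bot : rho bot = 0.
Hypothesis rho_lt : forall x y, x \in D -> y \in D -> x != y -> le x y -> rho x < rho y.
Hypothesis rho_cov : forall x y, cov x y -> rho y = (rho x).+1.
Hypothesis reach : forall x, x \in D -> exists2 s, path cov bot s & last bot s = x.

Lemma path_rho x s : path cov x s -> rho (last x s) = rho x + size s.
Proof.
elim: s x => [|y s IHs] x /=; first by rewrite addn0.
by case/andP=> /rho_cov e /IHs ->; rewrite e addSnnS.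
Qed.

Lemma path_cov_uniq x s : path cov x s -> uniq (x :: s).
Proof.
move=> cs; have : path ltn (rho x) (map rho s).
  by rewrite path_map; apply: sub_path cs => u v /rho_cov /= ->.
move=> h; apply: (@map_uniq _ _ rho).
exact: (@sorted_uniq _ ltn ltn_trans ltnn (map rho (x :: s)) h).
Qed.

Lemma path_dom x s : x \in D -> path cov x s -> {subset x :: s <= D}.
Proof.
elim: s x => [|y s IHs] x xD /=; first by move=> _ z; rewrite inE => /eqP->.
case/andP=> c cs z; rewrite inE => /predU1P[->//|].
by apply: IHs cs z; case/and4P: c.
Qed.

Lemma rho_card x : x \in D -> rho x < #|D|.
Proof.
case/reach=> s cs <-; rewrite path_rho // rho_bot add0n.
have := uniq_leq_size (path_cov_uniq cs) (_ : {subset _ <= enum D}); rewrite /= -cardE; apply.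
by move=> z /(path_dom bot_dom cs); rewrite mem_enum.
Qed.

(** A chain visits distinct elements of [D] and so has fewer than [#|D|] steps; the bound on [k] in
    [rank] cuts nothing off. *)
Lemma rank_rho x : x \in D -> rank D le bot x = rho x.
Proof.
move=> xD; apply/eqP; rewrite eqn_leq; apply/andP; split.
  apply/bigmax_leqP=> k _; case: ifP => // /existsP[t /andP[ct /eqP <-]].
  by rewrite path_rho // size_tuple leq_addl.
have [s cs ls] := reach xD; have es : size s = rho x by rewrite -ls path_rho // rho_bot.
have lt : size s < #|D|.+1 by rewrite es ltnS ltnW ?rho_card.
rewrite /rank (bigD1 (Ordinal lt)) //= leq_max -es ifT ?leqnn //.
by apply/existsP; exists (in_tuple s); rewrite cs ls eqxx.
Qed.

Local Open Scope ring_scope.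

(** The Moebius recursion has only one solution. [mu_aux] follows it as soon as its fuel is at least
    [rho y], and every rank is below [#|D|]. *)
Lemma mobius_uniq (f : U -> int) : f bot = 1 ->
  (forall y, y \in D -> y != bot -> \sum_(z in D | le z y) f z = 0) ->
  forall y, y \in D -> mobius D le bot y = f y.
Proof.
move=> f_bot f_sum y yD; rewrite /mobius.
have : (rho y <= #|D|)%N by rewrite ltnW ?rho_card.
elim: #|D| y yD => [|k IHk] y yD /=; case: eqVneq => [<-//|ne] le_k.
  by have := rho_lt bot_dom yD ne (le_bot yD); rewrite rho_bot ltnNge le_k.
rewrite le_bot //; have := f_sum y yD; rewrite eq_sym => /(_ ne).
rewrite (bigD1 y) ?yD ?le_refl //= => /eqP; rewrite addr_eq0 => /eqP->.
congr (- _); apply: eq_big => [z|z /and3P[zD _ /andP[zy lzy]]].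
  rewrite /Defs.ltP; case zD: (z \in D) => //=.
  by rewrite le_bot //= andbC.
by apply: IHk => //; rewrite -ltnS; apply: leq_trans le_k; apply: rho_lt.
Qed.

End GradedPoset.

(** * A sign-reversing involution on cut words *)

Section Toggle.
Local Open Scope ring_scope.
Variables (T : Type) (r r' : rel T).
Hypothesis r'E : forall a b, r' a b = ~~ r a b.

(** With [a] pinned to the left factor, the involution fails only where it would have to move [a]
    itself: at the cut [i = 0], when [a] can be put in front of [w]. *)
Lemma toggle_path a (w : seq T) :
  \sum_(i < (size w).+1) (-1) ^+ i * (path r a (take i w) && sorted r' (drop i w))%:R
  = (path r' a w)%:R :> int.
Proof.
elim: w a => [|b w IHw] a; first by rewrite big_ord_recl big_ord0 /= addr0 mul1r.
rewrite big_ord_recl /= mul1r.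
under eq_bigr => i _ do rewrite exprS mulN1r mulNr -andbA -mulnb natrM mulrCA.
rewrite sumrN -mulr_sumr IHw r'E.
by case: (r a b); rewrite ?mul1r ?mul0r ?subrr ?subr0.
Qed.

(* The element at the junction of the two factors can be moved either way. *)
Lemma toggle_sorted (w : seq T) : (0 < size w)%N ->
  \sum_(i < (size w).+1) (-1) ^+ i * (sorted r (take i w) && sorted r' (drop i w))%:R
  = 0 :> int.
Proof.
case: w => // a w _; rewrite big_ord_recl /= mul1r.
under eq_bigr => i _ do rewrite exprS mulN1r mulNr.
by rewrite sumrN toggle_path subrr.
Qed.

End Toggle.

Section Chains.
Variables (U : finType) (c : rel U).

Fixpoint chains k (x : U) : seq (seq U) :=
  if k is k'.+1 then [seq y :: s | y <- enum (c x), s <- chains k' y] else [:: [::]].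

Lemma mem_chains k x s : (s \in chains k x) = (size s == k) && path c x s.
Proof.
elim: k x s => [|k IHk] x s; first by rewrite inE; case: s.
apply/allpairsPdep/andP=> [[y [t [yx tk ->]]]|].
  by move: tk yx; rewrite IHk mem_enum unfold_in /= eqSS => /andP[-> ->] ->.
case: s => [|y t] /= [] // /eqP[tk] /andP[xy ct].
by exists y, t; rewrite mem_enum IHk tk eqxx ct.
Qed.

Lemma chains_uniq k x : uniq (chains k x).
Proof.
elim: k x => [|k IHk] x //=; apply: allpairs_uniq_dep; first exact: enum_uniq.
  by move=> y _.
by move=> [y s] [z t] _ _ /= [-> ->].
Qed.

Lemma sum_chains_cat (R : nmodType) i j x (F : seq U -> seq U -> R) :
  (\sum_(s <- chains i x) \sum_(t <- chains j (last x s)) F s t =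
   \sum_(s <- chains (i + j) x) F (take i s) (drop i s))%R.
Proof.
elim: i x F => [|i IHi] x F.
  by rewrite big_seq1; apply: eq_bigr => s _; rewrite take0 drop0.
rewrite addSn /= !big_allpairs_dep; apply: eq_bigr => y _.
exact: (IHi y (fun s t => F (y :: s) t)).
Qed.

End Chains.

Lemma sum_at_most_one (T : eqType) (L : seq T) (p : pred T) (b : bool) : uniq L ->
  (b -> exists2 s, s \in L & p s) -> (forall s, s \in L -> p s -> b) ->
  (forall s t, s \in L -> t \in L -> p s -> p t -> s = t) ->
  (\sum_(s <- L) (p s)%:R = b%:R :> int)%R.
Proof.
move=> uL ex only un; case: b ex only => [[//|s sL ps] _|_ only].
  rewrite (bigD1_seq s) //= ps big1_seq ?addr0 // => t /andP[ts tL].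
  by case pt: (p t) => //; rewrite (un _ _ tL sL pt ps) eqxx in ts.
by rewrite big1_seq // => t /= tL; case pt: (p t) => //; have := only t tL pt.
Qed.

(** * Moebius functions as signed counts of chains *)

Section Fibers.
Local Open Scope ring_scope.
Variables (U : finType) (c : rel U) (lam : U -> U -> nat) (x0 : U).
Variables (V : finType) (DV : {set V}) (leV : rel V) (botV : V) (rho : V -> nat).
(** Two instances are intended: [pi] sends a chain to its endpoint in the original poset, with [r']
    being [ltn], or to its class, with [r'] being [geq]. In both, every element above [pi s] is
    reached from [s] by exactly one [r']-sorted extension. *)
Variables (pi : seq U -> V) (r r' : rel nat).
Local Notation cov := (covers DV leV).
Hypothesis bot_dom : botV \in DV.
Hypothesis le_bot : forall X, X \in DV -> leV botV X.
Hypothesis le_refl : forall X, X \in DV -> leV X X.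
Hypothesis rho_bot : rho botV = 0%N.
Hypothesis rho_lt : forall X Y, X \in DV -> Y \in DV -> X != Y -> leV X Y -> (rho X < rho Y)%N.
Hypothesis rho_cov : forall X Y, cov X Y -> rho Y = (rho X).+1.
Hypothesis reach : forall X, X \in DV -> exists2 s, path cov botV s & last botV s = X.
Hypothesis r'E : forall a b, r' a b = ~~ r a b.
Hypothesis pi_nil : pi [::] = botV.
Hypothesis pi_dom : forall s, path c x0 s -> pi s \in DV.
Hypothesis pi_rho : forall s, path c x0 s -> rho (pi s) = size s.
Hypothesis ext_le : forall s t, path c x0 (s ++ t) -> leV (pi s) (pi (s ++ t)).
Hypothesis ext_ex : forall s Y, path c x0 s -> Y \in DV -> leV (pi s) Y ->
  exists t, [/\ path c (last x0 s) t, sorted r' (word lam (last x0 s) t) & pi (s ++ t) = Y].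
Hypothesis ext_uniq : forall s t t', path c x0 (s ++ t) -> path c x0 (s ++ t') ->
  sorted r' (word lam (last x0 s) t) -> sorted r' (word lam (last x0 s) t') ->
  pi (s ++ t) = pi (s ++ t') -> t = t'.

Let f Y : int := (-1) ^+ rho Y *
  \sum_(s <- chains c (rho Y) x0) (sorted r (word lam x0 s) && (pi s == Y))%:R.

(** Serves to trade the condition [leV (pi s) Y] under a sum for a sum over the second factors of
    cut chains. *)
Lemma ext_count i s Y : s \in chains c i x0 -> Y \in DV ->
  \sum_(t <- chains c (rho Y - i) (last x0 s))
     (sorted r' (word lam (last x0 s) t) && (pi (s ++ t) == Y))%:R = (leV (pi s) Y)%:R :> int.
Proof.
rewrite mem_chains => /andP[/eqP si cs] YD; apply: sum_at_most_one.
- exact: chains_uniq.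
- move=> /(ext_ex cs YD)[t [ct st eY]]; exists t; last by rewrite st eY eqxx.
  have cst : path c x0 (s ++ t) by rewrite cat_path cs.
  by rewrite mem_chains ct andbT -eY pi_rho // size_cat si addKn.
- move=> t; rewrite mem_chains => /andP[_ ct] /andP[_ /eqP <-].
  by apply: ext_le; rewrite cat_path cs.
- move=> t t'; rewrite !mem_chains => /andP[_ ct] /andP[_ ct'] /andP[st /eqP e] /andP[st' /eqP e'].
  by apply: (@ext_uniq s) => //; rewrite ?cat_path ?cs ?e ?e'.
Qed.

(** Regroups chains by their image; the rank of the image is the length of the chain, so the sign
    depends on the length alone. *)
Lemma fiber_sum (L : pred V) k (a : seq U -> int) :
  (forall Z, Z \in DV -> L Z -> (rho Z <= k)%N) ->
  \sum_(Z in DV | L Z) (-1) ^+ rho Z * (\sum_(s <- chains c (rho Z) x0) a s * (pi s == Z)%:R)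
  = \sum_(i < k.+1) (-1) ^+ i * \sum_(s <- chains c i x0) a s * (L (pi s))%:R.
Proof.
move=> Lk.
transitivity (\sum_(Z in DV | L Z) \sum_(i < k.+1) \sum_(s <- chains c i x0)
    (-1) ^+ i * (a s * (pi s == Z)%:R)).
  apply: eq_bigr => Z /andP[ZD LZ]; have lt : (rho Z < k.+1)%N by rewrite ltnS Lk.
  rewrite (bigD1 (Ordinal lt)) //= [X in _ + X]big1 ?addr0 ?mulr_sumr // => i iZ.
  rewrite big1_seq // => s /=; rewrite mem_chains => /andP[/eqP si cs].
  case: eqP => e; rewrite ?mulr0 //; case/eqP: iZ; apply/val_inj.
  by rewrite /= -e pi_rho.
rewrite exchange_big; apply: eq_bigr => i _; rewrite exchange_big mulr_sumr.
apply: eq_big_seq => s; rewrite mem_chains => /andP[_ cs].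
rewrite -mulr_sumr -mulr_sumr; congr (_ * (_ * _)).
have [LS|nL] := boolP (L (pi s)).
  rewrite (bigD1 (pi s)) ?LS ?pi_dom //= eqxx big1 ?addr0 // => Z /andP[_ ne].
  by rewrite eq_sym (negPf ne).
rewrite big1 // => Z /andP[_ LZ]; case: eqP => // e; by rewrite e LZ in nL.
Qed.

Lemma mobius_fiber Y : Y \in DV -> mobius DV leV botV Y = f Y.
Proof.
apply: (mobius_uniq bot_dom le_bot le_refl rho_bot rho_lt rho_cov reach) => {Y}.
  by rewrite /f rho_bot big_seq1 pi_nil eqxx mulr1.
move=> Y YD Yb; pose k := rho Y.
have k0 : (0 < k)%N.
  by rewrite -rho_bot; apply: rho_lt; rewrite // 1?eq_sym //; apply: le_bot.
transitivity (\sum_(Z in DV | leV Z Y) (-1) ^+ rho Z *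
    (\sum_(s <- chains c (rho Z) x0) (sorted r (word lam x0 s))%:R * (pi s == Z)%:R : int)).
  by apply: eq_bigr => Z _; congr (_ * _); apply: eq_bigr => s _; rewrite -mulnb natrM.
rewrite (@fiber_sum (fun Z => leV Z Y) k); last first.
  move=> Z ZD ZY; have [->//|ne] := eqVneq Z Y; exact/ltnW/rho_lt.
(* By [ext_count], a chain ending at some [Z] below [Y] and its [r']-sorted extension to [Y] form
   one chain of length [k] with a marked cut. For a fixed chain, the signed sum over cuts vanishes
   by [toggle_sorted]. *)
transitivity (\sum_(i < k.+1) \sum_(s <- chains c k x0)
   (-1) ^+ i * (sorted r (take i (word lam x0 s)) && sorted r' (drop i (word lam x0 s)))%:R
     * (pi s == Y)%:R : int).
  apply: eq_bigr => i _; have ik : (i <= k)%N by rewrite -ltnS.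
  transitivity (\sum_(s <- chains c i x0) \sum_(t <- chains c (k - i) (last x0 s))
    (-1) ^+ i * (sorted r (word lam x0 s) && sorted r' (word lam (last x0 s) t))%:R
       * (pi (s ++ t) == Y)%:R : int).
    rewrite mulr_sumr; apply: eq_big_seq => s si.
    rewrite -(ext_count si YD) mulrA mulr_sumr; apply: eq_bigr => t _.
    by rewrite -!mulnb !natrM !mulrA.
  rewrite (@sum_chains_cat _ c int i (k - i) x0 (fun s t =>
    (-1) ^+ i * (sorted r (word lam x0 s) && sorted r' (word lam (last x0 s) t))%:R
       * (pi (s ++ t) == Y)%:R)) subnKC //.
  apply: eq_big_seq => s; rewrite mem_chains => /andP[/eqP sk _].
  rewrite cat_take_drop; congr (_ * (_ && _)%:R * _); congr (sorted _ _).
    rewrite -{2}(cat_take_drop i s) /word pairmap_cat take_size_cat //.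
    by rewrite size_pairmap size_takel // sk.
  rewrite -{3}(cat_take_drop i s) /word pairmap_cat drop_size_cat //.
  by rewrite size_pairmap size_takel // sk.
rewrite exchange_big big1_seq // => s /=; rewrite mem_chains => /andP[/eqP sk cs].
rewrite -mulr_suml; have ek : k = size (word lam x0 s) by rewrite size_pairmap sk.
by rewrite ek toggle_sorted ?mul0r // -ek.
Qed.

(** All elements of rank [k] carry the same sign, so nothing cancels and the absolute value counts
    the [r]-sorted chains of all fibers. *)
Lemma whitney1_fiber k : absz (whitney1 DV leV botV k) =
  size [seq s <- chains c k x0 | sorted r (word lam x0 s)].
Proof.
have rk X : X \in DV -> rank DV leV botV X = rho X.
  exact: (rank_rho bot_dom rho_bot rho_cov reach).
rewrite /whitney1.
transitivity (absz ((-1) ^+ k * \sum_(s <- chains c k x0) (sorted r (word lam x0 s))%:R : int)).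
  congr absz.
  transitivity (\sum_(Z in DV | rho Z == k) (-1) ^+ k * (\sum_(s <- chains c k x0)
      (sorted r (word lam x0 s) && (pi s == Z))%:R : int)).
    apply: eq_big => [Z|Z /andP[ZD]]; first by case ZD: (Z \in DV) => //=; rewrite rk.
    by rewrite rk // => /eqP e; rewrite mobius_fiber // /f e.
  rewrite -mulr_sumr exchange_big; congr (_ * _); apply: eq_big_seq => s.
  rewrite mem_chains => /andP[/eqP sk cs].
  rewrite (bigD1 (pi s)) ?pi_dom ?pi_rho ?sk ?eqxx //= andbT big1 ?addr0 // => Z /andP[_ ne].
  by rewrite [pi s == Z]eq_sym (negPf ne) andbF.
have -> : \sum_(s <- chains c k x0) (sorted r (word lam x0 s))%:R =
    (size [seq s <- chains c k x0 | sorted r (word lam x0 s)])%:R :> int.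
  rewrite size_filter -sum1_count natr_sum [RHS]big_mkcond; apply: eq_bigr => s _.
  by case: sorted.
by rewrite abszMsign natz absz_nat.
Qed.

Lemma whitney2_fiber k (q : pred (seq U)) :
  (forall Y, Y \in DV -> rho Y = k -> exists s, [/\ path c x0 s, q s & pi s = Y]) ->
  (forall s t, path c x0 s -> path c x0 t -> q s -> q t -> pi s = pi t -> s = t) ->
  whitney2 DV leV botV k = size [seq s <- chains c k x0 | q s].
Proof.
move=> surj inj; rewrite /whitney2; set L := [seq s <- _ | _].
have LP s : s \in L -> [/\ path c x0 s, q s & size s = k].
  by rewrite mem_filter mem_chains => /andP[qs /andP[/eqP sk cs]].
rewrite -(size_map pi) -(card_uniqP _); last first.
  rewrite map_inj_in_uniq ?filter_uniq ?chains_uniq // => s t /LP[cs qs _] /LP[ct qt _].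
  exact: inj.
apply: eq_card => Y; rewrite inE; apply/andP/mapP=> [[YD]|[s /LP[cs _ sk] ->]].
  rewrite (rank_rho bot_dom rho_bot rho_cov reach) // => /eqP e.
  have [s [cs qs eY]] := surj Y YD e.
  by exists s => //; rewrite mem_filter qs mem_chains cs andbT -(pi_rho cs) eY e /=.
by rewrite pi_dom // (rank_rho bot_dom rho_bot rho_cov reach) ?pi_dom // pi_rho // sk.
Qed.

End Fibers.

(** * Whitney duals from EW-labelings *)

Lemma pairwise_total (T : eqType) (r : rel T) (s : seq T) :
  pairwise r s -> {in s &, forall x y, [|| x == y, r x y | r y x]}.
Proof.
elim: s => [|a s IHs] //= /andP[/allP ra ps] x y.
rewrite !inE => /predU1P[->|xs] /predU1P[->|ys].
- by rewrite eqxx.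
- by rewrite (ra y ys) orbT.
- by rewrite (ra x xs) !orbT.
- exact: IHs ps x y xs ys.
Qed.

Section EWDual.
Variables (U : finType) (D : {set U}) (le : rel U) (bot : U) (rho : U -> nat).
Variable lam : U -> U -> nat.
Local Notation cov := (covers D le).
Local Notation word := (word lam).
Local Notation dec w := (sorted geq w).
Hypothesis bot_dom : bot \in D.
Hypothesis le_bot : forall x, x \in D -> le bot x.
Hypothesis le_refl : reflexive le.
Hypothesis le_trans : transitive le.
Hypothesis le_anti : {in D &, antisymmetric le}.
Hypothesis rho_bot : rho bot = 0.
Hypothesis rho_cov : forall x y, cov x y -> rho y = (rho x).+1.
Hypothesis EW : EW_labeling D le bot lam.

Definition cset (s : seq U) : {set U} := [set z in bot :: s].

(** [qstep] relates arbitrary sets, and a connecting path may leave the saturated chains, where no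
    label word is defined. Invariance of the multiset of labels is therefore left to be verified for
    the labeling at hand. *)
Hypothesis exchange_word : forall s t, path cov bot s -> path cov bot t ->
  last bot s = last bot t -> connect (qstep D le lam) (cset s) (cset t) ->
  perm_eq (word bot s) (word bot t).

Lemma path_end_dom x s : x \in D -> path cov x s -> last x s \in D.
Proof. by move=> xD cs; apply: (path_dom xD cs); apply: mem_last. Qed.

Lemma cov_lt x y : cov x y -> le x y /\ x != y.
Proof. by case/and4P=> _ _ /andP[]. Qed.

Lemma path_cov_le x s : path cov x s -> le x (last x s).
Proof.
elim: s x => [|y s IHs] x //= /andP[c /IHs]; apply: le_trans; exact: (cov_lt c).1.
Qed.

Lemma reach_le x y : x \in D -> y \in D -> le x y ->
  exists s, [/\ path cov x s, last x s = y & increasing (word x s)].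
Proof.
move=> xD yD xy; have [ER _ _] := EW; have [s [[/andP[cs /eqP ls] inc] _]] := ER x y xD yD xy.
by exists s.
Qed.

Lemma word_unique x s t : path cov x s -> path cov x t -> last x s = last x t ->
  word x s = word x t -> s = t.
Proof.
have [_ _ inj] := EW => cs ct e; apply: (inj x (last x t)); rewrite /maxchain ?cs ?ct ?e eqxx //.
Qed.

Lemma rho_strict x y : x \in D -> y \in D -> x != y -> le x y -> rho x < rho y.
Proof.
move=> xD yD ne /(reach_le xD yD)[[|z s] [cs ls _]]; first by rewrite -ls eqxx in ne.
by rewrite -ls (path_rho rho_cov cs) /= addnS ltnS leq_addr.
Qed.

Lemma reach_bot x : x \in D -> exists2 s, path cov bot s & last bot s = x.
Proof. by move=> xD; have [s [cs ls _]] := reach_le bot_dom xD (le_bot xD); exists s. Qed.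

Lemma chain_seq_cset s : path cov bot s -> chain_seq le (cset s) = bot :: s.
Proof.
move=> cs; have sub := path_dom bot_dom cs.
have srt : sorted le (bot :: s) by apply: sub_path cs => u v /cov_lt[].
have pe : perm_eq (enum (cset s)) (bot :: s).
  apply: uniq_perm; rewrite ?enum_uniq ?(path_cov_uniq rho_cov cs) //.
  by move=> z; rewrite mem_enum inE.
have mem z : z \in enum (cset s) -> z \in bot :: s by rewrite (perm_mem pe).
have tot : {in enum (cset s) &, total le}.
  move=> u v /mem us /mem vs.
  have := pairwise_total (etrans (esym (sorted_pairwise le_trans _)) srt) us vs.
  by case/or3P=> [/eqP->|->|->]; rewrite ?le_refl ?orbT.
rewrite /chain_seq -[RHS](sorted_sort le_trans srt).
apply/perm_sort_inP => //; first by move=> u v w _ _ _; apply: le_trans.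
by move=> u v /mem/sub uD /mem/sub vD; apply: le_anti.
Qed.

Lemma satchainP (c : {set U}) :
  reflect (exists2 s, path cov bot s & c = cset s) (satchain D le bot c).
Proof.
apply: (iffP and3P) => [[ne /eqP hd srt]|[s cs ->]]; last first.
  by rewrite chain_seq_cset //= eqxx.
case e: (chain_seq le c) ne hd srt => [//|x s] _ /= hx cs; subst x; exists s => //.
by apply/setP=> z; rewrite inE -e mem_sort mem_enum.
Qed.

Lemma satchain_cset s : path cov bot s -> satchain D le bot (cset s).
Proof. by move=> cs; apply/satchainP; exists s. Qed.

Lemma chain_top_cset s : path cov bot s -> chain_top le bot (cset s) = last bot s.
Proof. by move=> cs; rewrite /chain_top chain_seq_cset. Qed.

Lemma rho_nth x s i : path cov x s -> i < size s -> rho (nth x s i) = rho x + i.+1.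
Proof.
elim: s x i => [|y s IHs] x [|i] //= /andP[c cs] lt; rewrite ?(rho_cov c) ?addn1 //.
by rewrite (set_nth_default y) // IHs // (rho_cov c) addSnnS.
Qed.

(** In a chain from [bot] the rank of an element is its position, so inclusion of sets forces
    agreement position by position. *)
Lemma cset_sub s t : path cov bot s -> path cov bot t -> cset s \subset cset t ->
  exists u, t = s ++ u.
Proof.
move=> cs ct /subsetP sub; exists (drop (size s) t).
have key i : i < size s -> i < size t /\ nth bot s i = nth bot t i.
  move=> lt; have := sub (nth bot s i); rewrite !inE mem_nth // orbT => /(_ isT).
  case/predU1P=> [e|/(nthP bot)[j jt ej]].
    by have := rho_nth cs lt; rewrite e rho_bot.
  have := rho_nth ct jt; rewrite ej (rho_nth cs lt) => /addnI[e].
  by rewrite -e in ej jt.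
have le_st : size s <= size t.
  by case: (size s) key => // k /(_ k (ltnSn k))[].
rewrite -{1}(cat_take_drop (size s) t); congr (_ ++ _).
apply: (@eq_from_nth _ bot); rewrite size_takel // => i lt.
by rewrite nth_take // (key i lt).2.
Qed.

Lemma qstep_sym : symmetric (qstep D le lam).
Proof. by move=> c d; rewrite /qstep orbC. Qed.

Definition cls s := chain_class D le bot lam (cset s).

Lemma chain_simE s t : path cov bot s -> path cov bot t ->
  chain_sim D le bot lam (cset s) (cset t) =
    (last bot s == last bot t) && connect (qstep D le lam) (cset s) (cset t).
Proof. by move=> cs ct; rewrite /chain_sim !satchain_cset // !chain_top_cset. Qed.

Lemma mem_cls s t : path cov bot s -> path cov bot t ->
  (cset t \in cls s) =
    (last bot s == last bot t) && connect (qstep D le lam) (cset s) (cset t).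
Proof. by move=> cs ct; rewrite inE chain_simE. Qed.

Lemma cset_in_cls s : path cov bot s -> cset s \in cls s.
Proof. by move=> cs; rewrite mem_cls // eqxx connect0. Qed.

Lemma cls_mem_eq s t : path cov bot s -> path cov bot t -> cset t \in cls s -> cls s = cls t.
Proof.
move=> cs ct; rewrite mem_cls // => /andP[/eqP e conn]; apply/setP=> c.
have [/satchainP[u cu ->]|nc] := boolP (satchain D le bot c); last first.
  by rewrite !inE /chain_sim (negPf nc) !andbF.
rewrite !mem_cls // e; case: eqP => //= _.
have csym := sym_connect_sym qstep_sym.
by apply/idP/idP => h; apply: connect_trans h; rewrite // csym.
Qed.

Lemma connect_exchange s1 a b b' c t : path cov bot (s1 ++ [:: b, c & t]) -> last bot s1 = a ->
  cov a b' -> cov b' c -> lam a b < lam b c -> lam a b' = lam b c -> lam b' c = lam a b ->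
  connect (qstep D le lam) (cset (s1 ++ [:: b, c & t])) (cset (s1 ++ [:: b', c & t])).
Proof.
move=> cs ea ab' b'c lt e e'; apply: connect1; apply/orP; left.
have := path_cov_uniq rho_cov cs; move: (cs).
rewrite cat_path ea => /and4P[_ ab bc _].
rewrite -cat_cons cat_uniq => /and3P[_ /hasPn dis /= /andP[nb _]].
apply/existsP; exists a; apply/existsP; exists b; apply/existsP; exists c; apply/existsP; exists b'.
rewrite ab bc ab' b'c lt e e' !eqxx /= !inE !mem_cat !inE !eqxx !orbT /=.
have -> : (a == bot) || [|| a \in s1, a == b, a == c | a \in t].
  have : a \in bot :: s1 by rewrite -ea mem_last.
  by rewrite inE => /predU1P[->|->]; rewrite ?eqxx ?orbT.
apply/eqP/setP=> z; rewrite !inE !mem_cat !inE.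
have [->|zb] := eqVneq z b; last by do ?[case: (_ == _) | case: (_ \in _)].
have := dis b; rewrite !inE eqxx => /(_ isT) /norP[/negPf-> /negPf->] /=.
by move: nb; rewrite inE => /norP[/negPf-> /negPf->]; rewrite !orbF.
Qed.

(** The insertion step of an insertion sort: exchanges at ascents push the label [lam x y] upwards
    past the larger labels. The lower part [s1] is carried along because switching is available only
    in chains from [bot]. *)
Lemma insert_dec s s1 x y : path cov bot s1 -> last bot s1 = x ->
  path cov x (y :: s) -> dec (word y s) ->
  exists s', [/\ path cov x s', last x s' = last y s, dec (word x s'),
    perm_eq (word x s') (word x (y :: s)) &
    connect (qstep D le lam) (cset (s1 ++ y :: s)) (cset (s1 ++ s'))].
Proof.
elim: s s1 x y => [|z s IHs] s1 x y cs1 ls1.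
  by move=> c _; exists [:: y]; split=> //; apply: connect0.
move=> cs ds; have [le_yz|lt] := leqP (lam y z) (lam x y).
  by exists (y :: z :: s); split; rewrite ?connect0 //= le_yz.
have [_ sw _] := EW; have /and3P[cxy cyz czs] := cs.
have := sw (belast bot s1) [::] x y z; rewrite lt.
have -> : belast bot s1 ++ [:: x; y; z] = bot :: s1 ++ [:: y; z].
  by rewrite -cat_cons (lastI bot s1) ls1 cat_rcons.
have hd : head x (belast bot s1) = bot by case: (s1) ls1.
have sc : sorted cov (bot :: s1 ++ [:: y; z]).
  by rewrite /= cat_path cs1 ls1 /= cxy cyz.
case/(_ hd sc isT) => y' [[cxy' cy'z e e'] _].
have cs1' : path cov bot (rcons s1 y') by rewrite rcons_path cs1 ls1.
have cy's : path cov y' (z :: s) by rewrite /= cy'z.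
have dzs : dec (word z s) by apply: path_sorted ds.
have [s' [cs' ls' ds' ps' conn]] := IHs _ _ _ cs1' (last_rcons _ _ _) cy's dzs.
exists (y' :: s'); split=> //=; first by rewrite cxy'.
(* The new first label [lam y z] bounds both the inserted label, by the ascent, and the old labels,
   which decrease after it. *)
- rewrite path_sortedE; last by move=> u v w h1 h2; apply: leq_trans h2 h1.
  rewrite ds' andbT; apply/allP=> q; rewrite (perm_mem ps') inE e.
  case/predU1P=> [->|qs] /=; first by rewrite e' ltnW.
  move: ds; rewrite /= path_sortedE; last by move=> u v w h1 h2; apply: leq_trans h2 h1.
  by case/andP=> /allP/(_ q qs).
- rewrite e; apply: perm_trans (_ : perm_eq _ [:: lam y z, lam x y & word z s]) _.
    by rewrite perm_cons (permPl ps') /= e'.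
  by apply/permP=> a /=; rewrite addnCA.
- apply: connect_trans (connect_exchange _ ls1 cxy' cy'z lt e e') _.
    by rewrite cat_path cs1 ls1.
  by rewrite !cat_rcons in conn.
Qed.

(** Insertion sort by exchanges. Weakly decreasing words are the ascent-free ones, so with [s1]
    empty this puts an ascent-free chain into every class. *)
Lemma sort_dec s s1 x : path cov bot s1 -> last bot s1 = x -> path cov x s ->
  exists s', [/\ path cov x s', last x s' = last x s, dec (word x s'),
    perm_eq (word x s') (word x s) &
    connect (qstep D le lam) (cset (s1 ++ s)) (cset (s1 ++ s'))].
Proof.
elim: s s1 x => [|y s IHs] s1 x cs1 ls1; first by exists [::]; split=> //; apply: connect0.
case/andP=> cxy cs; have cs1' : path cov bot (rcons s1 y) by rewrite rcons_path cs1 ls1.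
have [t [ct lt dt pt conn]] := IHs _ _ cs1' (last_rcons _ _ _) cs.
have [|s' [cs' ls' ds' ps' conn']] := @insert_dec t s1 x y cs1 ls1 _ dt.
  by rewrite /= cxy.
exists s'; split=> //=; first by rewrite ls'.
  by apply: perm_trans ps' _; rewrite /= perm_cons.
by apply: connect_trans conn'; rewrite !cat_rcons in conn.
Qed.

Lemma dec_unique x s t : path cov x s -> path cov x t -> last x s = last x t ->
  dec (word x s) -> dec (word x t) -> perm_eq (word x s) (word x t) -> s = t.
Proof.
move=> cs ct e ds dt pe; apply: word_unique e _ => //.
apply: (sorted_eq _ _ ds dt pe); first by move=> u v w h1 h2; apply: leq_trans h2 h1.
by move=> u v /andP[h1 h2]; apply/eqP; rewrite eqn_leq; apply/andP.
Qed.

(** Conversely to [exchange_word], two chains with the same end and the same multiset of labels sort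
    to the same ascent-free chain. From here on a class is handled through these two data. *)
Lemma cls_eq s t : path cov bot s -> path cov bot t ->
  cls s = cls t <-> last bot s = last bot t /\ perm_eq (word bot s) (word bot t).
Proof.
move=> cs ct; split=> [e|[e pe]].
  have := cset_in_cls ct; rewrite -e mem_cls // => /andP[/eqP el conn].
  by split=> //; apply: exchange_word.
apply: cls_mem_eq => //; rewrite mem_cls // e eqxx /=.
have [s' [cs' ls' ds' ps' conn]] := @sort_dec s [::] bot isT erefl cs.
have [t' [ct' lt' dt' pt' conn']] := @sort_dec t [::] bot isT erefl ct.
have est : s' = t'.
  apply: (@dec_unique bot) => //; first by rewrite ls' lt'.
  by apply: perm_trans ps' (perm_trans pe _); rewrite perm_sym.
apply: connect_trans conn _; rewrite est (sym_connect_sym qstep_sym).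
exact: conn'.
Qed.


(** * The ordered set of classes *)

Local Notation Q := (Qdom D le bot lam).
Local Notation leQ := (Qle D le bot lam).
Local Notation botQ := (Qbot D le bot lam).

Lemma QdomP (X : {set {set U}}) : reflect (exists2 s, path cov bot s & X = cls s) (X \in Q).
Proof.
apply: (iffP imsetP) => [[c]|[s cs ->]].
  by rewrite inE => /satchainP[s cs ->] ->; exists s.
by exists (cset s); rewrite ?inE ?satchain_cset.
Qed.

Lemma cls_dom s : path cov bot s -> cls s \in Q.
Proof. by move=> cs; apply/QdomP; exists s. Qed.

Lemma mem_cls_ex s c : path cov bot s -> c \in cls s ->
  exists t, [/\ path cov bot t, c = cset t & cls s = cls t].
Proof.
move=> cs cX; have := cX; rewrite inE => /and4P[_ /satchainP[t ct e] _ _]; subst c.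
by exists t; split=> //; apply: cls_mem_eq.
Qed.

Lemma cls_size s t : path cov bot s -> path cov bot t -> cls s = cls t -> size s = size t.
Proof.
move=> cs ct /(cls_eq cs ct)[e _]; apply/eqP; rewrite -(eqn_add2l (rho bot)).
by rewrite -!(path_rho rho_cov) // e.
Qed.

Lemma cls_cat s t u : path cov bot s -> path cov bot t -> cls s = cls t ->
  path cov bot (s ++ u) -> path cov bot (t ++ u) /\ cls (s ++ u) = cls (t ++ u).
Proof.
move=> cs ct /(cls_eq cs ct)[e pe] csu.
have ctu : path cov bot (t ++ u).
  by move: csu; rewrite !cat_path cs ct e.
split=> //; apply/(cls_eq csu ctu); rewrite !last_cat e; split=> //.
by rewrite /word !pairmap_cat e perm_cat2r.
Qed.

(** All chains of a class have the same size, so the choice is harmless; the predecessor discounts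
    [bot]. A class of a chain is nonempty and never meets the default [0]. *)
Definition cls_rank (X : {set {set U}}) : nat :=
  if [pick c in X] is Some c then #|c|.-1 else 0.

Lemma cls_rank_cls s : path cov bot s -> cls_rank (cls s) = size s.
Proof.
move=> cs; rewrite /cls_rank; case: pickP => [c|/(_ (cset s))]; last by rewrite cset_in_cls.
case/(mem_cls_ex cs)=> t [ct -> e]; rewrite (cls_size cs ct e) cardsE.
by have /card_uniqP-> := path_cov_uniq rho_cov ct.
Qed.

Lemma Qle_cat s u : path cov bot (s ++ u) -> leQ (cls s) (cls (s ++ u)).
Proof.
move=> csu; have cs : path cov bot s by move: csu; rewrite cat_path => /andP[].
apply: connect1; rewrite /Qstep !cls_dom //=; apply/exists_inP; exists (cset s).
  exact: cset_in_cls.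
apply/exists_inP; exists (cset (s ++ u)); first exact: cset_in_cls.
by apply/subsetP=> z; rewrite !inE mem_cat orbA => ->.
Qed.

(** By [cls_cat] a step between classes can start from any representative, so a whole path of steps
    lifts to an extension of the given chain [s]. *)
Lemma Qle_ex s Y : path cov bot s -> leQ (cls s) Y ->
  exists u, path cov bot (s ++ u) /\ Y = cls (s ++ u).
Proof.
move=> cs /connectP[p]; elim: p s cs Y => [|Z p IHp] s cs Y /=.
  by move=> _ ->; exists [::]; rewrite cats0.
case/andP=> /and3P[_ /QdomP[t ct eZ] /exists_inP[c cX /exists_inP[d dZ cd]]] pp eY.
subst Z; have [s' [cs' ec es]] := mem_cls_ex cs cX; have [t' [ct' ed et]] := mem_cls_ex ct dZ.
subst c d; have [u eu] := cset_sub cs' ct' cd; subst t'.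
have [csu eu] := cls_cat cs' cs (esym es) ct'.
rewrite et eu in pp eY; have [v [cv ->]] := IHp _ csu _ pp eY.
by exists (u ++ v); rewrite catA.
Qed.

Lemma botQE : botQ = cls [::].
Proof. by congr chain_class; apply/setP=> z; rewrite !inE. Qed.

Lemma Qle_bot X : X \in Q -> leQ botQ X.
Proof. by case/QdomP=> s cs ->; rewrite botQE; apply: (@Qle_cat [::] s). Qed.

Lemma cls_rank_lt X Y : X \in Q -> Y \in Q -> X != Y -> leQ X Y -> cls_rank X < cls_rank Y.
Proof.
case/QdomP=> s cs -> _ ne /(Qle_ex cs)[[|y u] [csu eY]]; subst Y.
  by rewrite cats0 eqxx in ne.
by rewrite !cls_rank_cls // size_cat /= addnS ltnS leq_addr.
Qed.

Lemma cls_neq s t : path cov bot s -> path cov bot t -> size s != size t -> cls s != cls t.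
Proof. by move=> cs ct; apply: contraNneq => /(cls_size cs ct)->. Qed.

Lemma cls_rank_cov X Y : covers Q leQ X Y -> cls_rank Y = (cls_rank X).+1.
Proof.
case/and4P=> /QdomP[s cs ->] _ /andP[ne /(Qle_ex cs)[[|y u] [csu eY]]] none; subst Y.
  by rewrite cats0 eqxx in ne.
case: u csu none {ne} => [|z u] csu none; first by rewrite !cls_rank_cls // size_cat addn1.
(* Were the extension longer than one element, the class of [s ++ [:: y]] would lie strictly
   between. *)
have e : s ++ [:: y, z & u] = (s ++ [:: y]) ++ z :: u by rewrite -catA.
rewrite e in csu none; have csy : path cov bot (s ++ [:: y]).
  by move: csu; rewrite cat_path => /andP[].
have := forall_inP none _ (cls_dom csy).
rewrite /Defs.ltP !Qle_cat // !cls_neq // !size_cat /= ?addn1 ?addnS neq_ltn.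
  by rewrite !ltnS leq_addr.
by rewrite ltnSn.
Qed.

Lemma cls_reach X : X \in Q -> exists2 p, path (covers Q leQ) botQ p & last botQ p = X.
Proof.
case/QdomP=> s; elim/last_ind: s X => [|s y IHs] X cs ->; first by exists [::]; rewrite // botQE.
have cs' : path cov bot s by move: cs; rewrite rcons_path => /andP[].
have [p pp lp] := IHs _ cs' erefl; exists (rcons p (cls (rcons s y))); last by rewrite last_rcons.
have XY : leQ (cls s) (cls (rcons s y)) by rewrite -cats1 Qle_cat ?cats1.
rewrite rcons_path pp lp /=; apply/and4P; split; rewrite ?cls_dom //.
  by rewrite /Defs.ltP XY cls_neq // size_rcons neq_ltn ltnSn.
apply/forall_inP=> Z ZQ; apply/negP=> /andP[/andP[ne1 le1] /andP[ne2 le2]].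
have := cls_rank_lt (cls_dom cs') ZQ ne1 le1; have := cls_rank_lt ZQ (cls_dom cs) ne2 le2.
by rewrite !cls_rank_cls // size_rcons ltnS => h /(leq_ltn_trans h); rewrite ltnn.
Qed.

Lemma inc_unique x s t : x \in D -> path cov x s -> path cov x t -> last x s = last x t ->
  increasing (word x s) -> increasing (word x t) -> s = t.
Proof.
move=> xD cs ct e is_ it; have [ER _ _] := EW; have le_s := path_cov_le cs.
have [s0 [_ un]] := ER _ _ xD (path_end_dom xD cs) le_s.
by rewrite -(un s) ?(un t) // /maxchain ?cs ?ct ?e eqxx.
Qed.

Theorem EW_whitney_dual : whitney_dual D le bot Q leQ botQ.
Proof.
have path_catl s t : path cov bot (s ++ t) -> path cov bot s /\ path cov (last bot s) t.
  by rewrite cat_path => /andP[].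
have Qrefl X : X \in Q -> leQ X X by move=> _; apply: connect0.
have botQ_dom : botQ \in Q by rewrite botQE cls_dom.
have botQ_rank : cls_rank botQ = 0 by rewrite botQE cls_rank_cls.
have end_dom s : path cov bot s -> last bot s \in D by apply: path_end_dom.
have end_rho s : path cov bot s -> rho (last bot s) = size s.
  by move=> cs; rewrite (path_rho rho_cov cs) rho_bot.
move=> k; split.
  (* Increasing extensions to a given endpoint are unique, so the Moebius function of the poset
     counts ascent-free chains, and each class contains one of these. *)
  rewrite (@whitney1_fiber U cov lam bot U D le bot rho (last bot) geq ltn) //.
  - rewrite (@whitney2_fiber U cov bot _ Q leQ botQ cls_rank cls _ _ _ _ _ _ k
      (fun s => dec (word bot s))) //.
    + exact: cls_rank_cov.
    + exact: cls_reach.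
    + exact: cls_dom.
    + exact: cls_rank_cls.
    + move=> _ /QdomP[s cs ->] _.
      have [t [ct lt dt pt _]] := @sort_dec s [::] bot isT erefl cs.
      by exists t; split=> //; apply/(cls_eq ct cs).
    + by move=> s t cs ct ds dt /(cls_eq cs ct)[e pe]; apply: (@dec_unique bot).
  - exact: rho_strict.
  - exact: reach_bot.
  - by move=> a b; rewrite /= ltnNge.
  - by move=> s t /path_catl[cs ct]; rewrite last_cat path_cov_le.
  - move=> s Y cs YD sY; have [t [ct lt inc]] := reach_le (end_dom _ cs) YD sY.
    by exists t; rewrite last_cat.
  - move=> s t t' /path_catl[cs ct] /path_catl[_ ct'] it it'; rewrite !last_cat => e.
    exact: (inc_unique (end_dom _ cs)).
(* With the roles exchanged, ascent-free extensions to a given class are unique, so increasing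
   chains are counted, and each element is the end of exactly one. *)
rewrite (@whitney1_fiber U cov lam bot _ Q leQ botQ cls_rank cls ltn geq) //.
- rewrite (@whitney2_fiber U cov bot U D le bot rho (last bot) _ _ _ _ _ _ k
      (fun s => increasing (word bot s))) //.
  + exact: reach_bot.
  + move=> Y YD _; have [t [ct lt inc]] := reach_le bot_dom YD (le_bot YD).
    by exists t.
  + by move=> s t cs ct is_ it e; apply: (inc_unique bot_dom).
- exact: Qle_bot.
- exact: cls_rank_lt.
- exact: cls_rank_cov.
- exact: cls_reach.
- by move=> a b; rewrite /= leqNgt.
- by rewrite botQE.
- exact: cls_dom.
- exact: cls_rank_cls.
- exact: Qle_cat.
- move=> s Y cs _ /(Qle_ex cs)[u [csu ->]]; have [_ cu] := path_catl _ _ csu.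
  have [t [ct lt dt pt _]] := @sort_dec u s _ cs erefl cu.
  exists t; split=> //; apply/cls_eq; rewrite ?cat_path ?cs // !last_cat lt; split=> //.
  by rewrite /word !pairmap_cat perm_cat2l.
move=> s t t' cst cst' dt dt' /(cls_eq cst cst')[]; rewrite !last_cat => e.
have [[_ ct] [_ ct']] := (path_catl _ _ cst, path_catl _ _ cst').
by rewrite /word !pairmap_cat perm_cat2l => pe; apply: dec_unique e dt dt' pe.
Qed.

End EWDual.

(** * Noncrossing partitions *)

Section NCTheory.
Variable n : nat.
Implicit Types (P Q : NCcarrier n) (i j k l a b c d m : 'I_n).

(** Comparing blocks by equality makes this an equivalence for every family [P], with no partition
    hypothesis to carry. *)
Definition same P i j := pblock P i == pblock P j.

Lemma same_refl P i : same P i i. Proof. exact: eqxx. Qed.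
Lemma same_sym P i j : same P i j = same P j i. Proof. exact: eq_sym. Qed.
Lemma same_trans P i j k : same P i j -> same P j k -> same P i k.
Proof. by rewrite /same => /eqP->. Qed.
Lemma same_left P i j k : same P i j -> same P i k = same P j k.
Proof. by rewrite /same => /eqP->. Qed.
Lemma same_right P i j k : same P i j -> same P k i = same P k j.
Proof. by rewrite /same => /eqP->. Qed.

Lemma NC_partition P : P \in NCdom n -> partition P [set: 'I_n].
Proof. by rewrite inE => /andP[]. Qed.

Lemma partition_cover P i : partition P [set: 'I_n] -> i \in cover P.
Proof. by move=> /cover_partition->; rewrite inE. Qed.

Lemma sameE P i j : partition P [set: 'I_n] -> same P i j = (j \in pblock P i).
Proof.
by move=> pP; rewrite /same eq_pblock ?(partition_trivIset pP) ?partition_cover.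
Qed.

Lemma pblock_in P i : partition P [set: 'I_n] -> pblock P i \in P.
Proof. by move=> pP; rewrite pblock_mem ?partition_cover. Qed.

Lemma block_pblock P B :
  partition P [set: 'I_n] -> B \in P -> exists2 i, i \in B & B = pblock P i.
Proof.
move=> pP BP; have [B0|[i iB]] := set_0Vmem B.
  by move: BP; rewrite B0 (partition0 pP).
by exists i => //; rewrite (def_pblock (partition_trivIset pP) BP iB).
Qed.

Lemma refinesP P Q : P \in NCdom n -> Q \in NCdom n ->
  reflect (forall i j, same P i j -> same Q i j) (refines P Q).
Proof.
move=> /NC_partition pP /NC_partition pQ; apply: (iffP forall_inP) => [PQ i j|PQ B BP].
  move=> ij; have /exists_inP[B BQ /subsetP sB] := PQ _ (pblock_in i pP).
  rewrite sameE // (def_pblock (partition_trivIset pQ) BQ (sB _ _)).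
    by rewrite sB // -sameE.
  by rewrite -sameE ?same_refl.
have [i iB defB] := block_pblock pP BP.
apply/exists_inP; exists (pblock Q i); first exact: pblock_in.
by apply/subsetP=> j; rewrite defB -!sameE //; apply: PQ.
Qed.

Lemma same_inj P Q : P \in NCdom n -> Q \in NCdom n -> same P =2 same Q -> P = Q.
Proof.
suff sub P' Q' : P' \in NCdom n -> Q' \in NCdom n -> same P' =2 same Q' -> P' \subset Q'.
  by move=> NP NQ e; apply/eqP; rewrite eqEsubset !sub.
move=> /NC_partition pP /NC_partition pQ e; apply/subsetP=> B BP.
have [i iB ->] := block_pblock pP BP.
suff -> : pblock P' i = pblock Q' i by apply: pblock_in.
by apply/setP=> j; rewrite -!sameE.
Qed.

Lemma NC_noncrossing P i j k l : P \in NCdom n ->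
  i < j -> j < k -> k < l -> same P i k -> same P j l -> same P i j.
Proof.
move=> NP ij jk kl ik jl; have pP := NC_partition NP.
move: NP; rewrite inE => /andP[_ /forallP/(_ i)/forallP/(_ j)/forallP/(_ k)/forallP/(_ l)].
rewrite ij jk kl /= => /exists_inPn/(_ _ (pblock_in i pP))/exists_inPn/(_ _ (pblock_in j pP)).
by rewrite -/(same P i j) -!sameE // !same_refl ik jl !andbT negbK.
Qed.

Lemma NC_intro P : partition P [set: 'I_n] ->
  (forall i j k l, i < j -> j < k -> k < l -> same P i k -> same P j l -> same P i j) ->
  P \in NCdom n.
Proof.
move=> pP ncP; rewrite inE pP; apply/forallP=> i; apply/forallP=> j.
apply/forallP=> k; apply/forallP=> l; apply/implyP=> /and3P[ij jk kl].
apply/exists_inPn=> B BP; apply/exists_inPn=> B' B'P.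
apply/negP=> /and5P[nBB iB kB jB' lB'].
have tP := partition_trivIset pP; move: nBB.
rewrite -(def_pblock tP BP iB) -(def_pblock tP B'P jB').
have s B0 u v : B0 \in P -> u \in B0 -> v \in B0 -> same P u v.
  by move=> B0P uB vB; rewrite /same !(def_pblock tP B0P).
by move/negP; apply; apply: (ncP i j k l) => //; [apply: (s B) | apply: (s B')].
Qed.

(* Shifted by one like the labels, so that [0] means that [m] is the minimum of
   its block. *)
Definition blockpred P m : nat := \max_(a : 'I_n | (a < m) && same P a m) a.+1.
(** For a partition its cardinality is [n] minus the number of blocks, which serves as the rank
    function. *)
Definition nonmin P : {set 'I_n} := [set m | 0 < blockpred P m].

Lemma blockpred_ge P a m : a < m -> same P a m -> a < blockpred P m.
Proof.
by move=> am s; rewrite /blockpred (bigD1 a) ?am //= leq_max leqnn.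
Qed.

Lemma blockpred_le P m : blockpred P m <= m.
Proof. by apply/bigmax_leqP=> a /andP[]. Qed.

Lemma blockpred_ex P m : m \in nonmin P -> exists a : 'I_n, [/\ blockpred P m = a.+1, a < m & same P a m].
Proof.
rewrite inE => pm; have [a Pa|none] := pickP (fun a : 'I_n => (a < m) && same P a m).
  rewrite /blockpred (bigmax_eq_arg a) //; case: arg_maxnP => // b /andP[bm sb] _.
  by exists b.
by move: pm; rewrite /blockpred big_pred0.
Qed.

Lemma nonminP P m : reflect (exists2 a : 'I_n, a < m & same P a m) (m \in nonmin P).
Proof.
apply: (iffP idP) => [/blockpred_ex[a [_ am s]]|[a am s]]; first by exists a.
by rewrite inE (leq_trans _ (blockpred_ge am s)).
Qed.

Lemma blockpred_le_nonmin P Q m : (forall i j, same P i j -> same Q i j) -> blockpred P m <= blockpred Q m.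
Proof.
move=> PQ; apply/bigmax_leqP=> a /andP[am s]; exact: blockpred_ge am (PQ _ _ s).
Qed.

Lemma min_ex P i : exists2 m : 'I_n, same P m i & (m <= i) && (m \notin nonmin P).
Proof.
have := @arg_minnP _ i (fun m : 'I_n => same P m i) (fun m => m) (same_refl P i).
case=> m s minm; exists m => //; rewrite minm ?same_refl //=.
apply/nonminP=> -[a am sa]; have := minm a (same_trans sa s); lia.
Qed.

Lemma min_uniq P i j : same P i j -> i \notin nonmin P -> j \notin nonmin P -> i = j.
Proof.
move=> s /nonminP ni /nonminP nj; apply/val_inj/eqP; rewrite /= eqn_leq.
apply/andP; split; rewrite leqNgt; apply/negP=> h.
  by apply: ni; exists j; rewrite // same_sym.
by apply: nj; exists i.
Qed.

Lemma nonmin_sub P Q : (forall i j, same P i j -> same Q i j) -> nonmin P \subset nonmin Q.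
Proof.
move=> PQ; apply/subsetP=> m /nonminP[a am s]; apply/nonminP; exists a => //; exact: PQ.
Qed.

(** The minima of the [P]-blocks of [i] and [j] are at most [i] and [j], hence still minima in [Q];
    lying in one block of [Q], they coincide. *)
Lemma merge_below P Q i j : (forall i j, same P i j -> same Q i j) -> same Q i j ->
  (forall m, m <= i -> m \in nonmin Q -> m \in nonmin P) ->
  (forall m, m <= j -> m \in nonmin Q -> m \in nonmin P) -> same P i j.
Proof.
move=> PQ s hi hj.
have [mi si /andP[li ni]] := min_ex P i; have [mj sj /andP[lj nj]] := min_ex P j.
have e : mi = mj.
  apply: (@min_uniq Q).
  - by rewrite (same_left _ (PQ _ _ si)) (same_right _ (PQ _ _ sj)).
  - by apply: contra ni; apply: hi.
  - by apply: contra nj; apply: hj.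
by rewrite -(same_left _ si) e.
Qed.

Lemma nonmin_eq P Q : P \in NCdom n -> Q \in NCdom n ->
  refines P Q -> nonmin Q \subset nonmin P -> P = Q.
Proof.
move=> NP NQ /(refinesP NP NQ) PQ /subsetP sub; apply: same_inj => // i j.
apply/idP/idP; first exact: PQ.
by move=> s; apply: (merge_below PQ s) => m _; apply: sub.
Qed.

(** Merges the blocks of [a] and [m] as the kernel of a map to blocks, which makes it a partition by
    construction. *)
Definition glue P a m : NCcarrier n :=
  preim_partition (fun i => if same P i m then pblock P a else pblock P i) [set: 'I_n].

Lemma glue_partition P a m : partition (glue P a m) [set: 'I_n].
Proof. exact: preim_partitionP. Qed.

Lemma same_glue P a m i j : same (glue P a m) i j =
  ((if same P i m then pblock P a else pblock P i)
   == (if same P j m then pblock P a else pblock P j)).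
Proof.
rewrite sameE ?glue_partition // /glue /preim_partition.
by rewrite pblock_equivalence_partition ?inE //; split=> // /eqP->.
Qed.

Lemma same_glue_sub P a m i j : same P i j -> same (glue P a m) i j.
Proof. by move=> s; rewrite same_glue (same_left m s) (eqP s). Qed.

Lemma same_glue_am P a m : same (glue P a m) a m.
Proof. by rewrite same_glue same_refl; case: ifP. Qed.

Lemma same_glueP P a m i j : same (glue P a m) i j ->
  same P i j \/ ((same P i a \/ same P i m) /\ (same P j a \/ same P j m)).
Proof.
rewrite same_glue; case: ifP => im; case: ifP => jm.
- by move=> _; right; split; right.
- by rewrite eq_sym => s; right; split; [right | left].
- by move=> s; right; split; [left | right].
- by left.
Qed.

(** If [i] lay inside the arc [c -- c'] and [j] outside, the two arcs would cross and [c] would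
    share the block of [i]. *)
Lemma nc_inside P c c' i j : P \in NCdom n -> same P c c' -> same P i j -> ~~ same P c i ->
  c < i < c' -> c < j < c'.
Proof.
move=> NP cc ij nci /andP[ci ic'].
have ne k : same P k i -> c != k /\ c' != k.
  move=> ki; split; apply: contraNneq nci => e; subst; rewrite -(same_right _ ki) //.
  exact: same_refl.
have [nj nj'] : c != j /\ c' != j by apply: ne; rewrite same_sym.
case: (ltngtP c j) => [cj|jc|/val_inj /eqP]; last by rewrite (negPf nj).
  case: (ltngtP j c') => [//|c'j|/val_inj/esym/eqP]; last by rewrite (negPf nj').
  by rewrite (NC_noncrossing NP ci ic' c'j cc ij) in nci.
have := NC_noncrossing NP jc ci ic'; rewrite same_sym ij cc => /(_ isT isT) s.
by rewrite -(same_left _ s) same_sym ij in nci.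
Qed.

(* Under [Q], nothing of the block of [m] lies strictly between its
   predecessor [a] and [m], so a pair of equivalent points separates [a] from
   [m] only if it meets the glued block. *)
Lemma glue_NC P Q a m : P \in NCdom n -> Q \in NCdom n -> refines P Q ->
  m \in nonmin Q -> blockpred Q m = a.+1 -> same Q a m -> a < m -> glue P a m \in NCdom n.
Proof.
move=> NP NQ /(refinesP NP NQ) PQ mQ pdm sam am.
have PR i j := @same_glue_sub P a m i j.
have RQ i j : same (glue P a m) i j -> same Q i j.
  case/same_glueP=> [/PQ //|[hi hj]].
  have h k : same P k a \/ same P k m -> same Q k m.
    by case=> /PQ // s; rewrite (same_left _ s).
  by rewrite (same_left _ (h _ hi)) same_sym h.
pose T i := same P i a || same P i m.
have TT i j : T i -> T j -> same (glue P a m) i j.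
  have h k : T k -> same (glue P a m) k m.
    by case/orP=> /PR // s; rewrite (same_left _ s) same_glue_am.
  by move=> /h s /h; rewrite (same_left _ s) same_sym.
have RT i j : same (glue P a m) i j -> T i -> T j.
  case/same_glueP=> [s|[_ [s|s]] _]; rewrite /T ?s ?orbT //.
  by rewrite !(same_left _ s).
have RN i j : same (glue P a m) i j -> ~~ T i -> same P i j.
  by case/same_glueP=> [//|[hi _]] /negP[]; apply/orP.
(* Outside [T], the [Q]-block of [m] has no element from [a] up to [m], because [a] is the
   predecessor of [m] there. *)
have sep c : same Q c m -> ~~ T c -> (c < a) = (c < m).
  move=> cm nT; have [cm'|mc] := ltnP c m; last by apply/negbTE; lia.
  have := blockpred_ge cm' cm; rewrite pdm => ca.
  have : c != a by apply: contraNneq nT => ->; rewrite /T same_refl.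
  by rewrite -val_eqE /=; lia.
(* An arc [c -- c'] in this [Q]-block but outside [T] has all of [T] on one side: points in one
   block of [P] by [nc_inside], and [a] with [m] by [sep]. *)
have side c c' i j : same P c c' -> same Q c i -> ~~ T c -> T i -> T j ->
    c < i < c' -> c < j < c'.
  move=> cc ci nT Ti Tj.
  have cm : same Q c m.
    by rewrite (same_right _ (RQ _ _ (TT _ _ (_ : T m) Ti))) // /T same_refl orbT.
  have nT' : ~~ T c' by rewrite /T -!(same_left _ cc).
  have cm' : same Q c' m by rewrite -(same_left _ (PQ _ _ cc)).
  have ne : ((c' : nat) == a) = false /\ ((c' : nat) == m) = false.
    by split; apply: contraNF nT' => /eqP/val_inj->; rewrite /T same_refl ?orbT.
  have aux : (c < a < c') = (c < m < c').
    by rewrite (sep c) // ![_ < c']ltnNge ![c' <= _]leq_eqVlt ne.1 ne.2 (sep c').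
  have nP k : T k -> ~~ same P c k.
    by move=> Tk; apply: contra nT => s; rewrite /T !(same_left _ s).
  have toa k : T k -> (c < k < c') = (c < a < c').
    have eqP2 u v : T u -> T v -> same P u v -> (c < u < c') = (c < v < c').
      move=> Tu Tv s; apply/idP/idP; first exact: nc_inside NP cc s (nP _ Tu).
      by apply: (nc_inside NP cc _ (nP _ Tv)); rewrite same_sym.
    move=> Tk; case/orP: (Tk) => s; last rewrite aux.
      by apply: eqP2; rewrite // /T same_refl.
    by apply: eqP2; rewrite // /T same_refl orbT.
  by rewrite !toa.
apply: NC_intro; first exact: glue_partition.
(* All four points share a block of [Q]. If exactly one of the arcs [i -- k] and [j -- l] lies in
   [T], the other one separates its ends, against [side]; if neither does, [P] itself is
   noncrossing. *)
move=> i j k l ij jk kl sik sjl.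
have Qij : same Q i j by apply: (NC_noncrossing NQ ij jk kl); apply: RQ.
case Ti: (T i); case Tj: (T j); first exact: TT.
- have := @side j l k i (RN _ _ sjl (negbT Tj)).
  rewrite -(same_right _ (RQ _ _ sik)) same_sym Qij Tj Ti (RT _ _ sik Ti) jk kl.
  by rewrite [j < i]ltnNge (ltnW ij) => /(_ isT isT isT isT isT).
- have := @side i k j l (RN _ _ sik (negbT Ti)).
  rewrite Qij Ti Tj (RT _ _ sjl Tj) ij jk [l < k]ltnNge (ltnW kl) andbF.
  by move=> /(_ isT isT isT isT isT).
- apply: PR; apply: (NC_noncrossing NP ij jk kl); apply: RN => //; by rewrite ?Ti ?Tj.
Qed.

(** The source of all intermediate partitions: any minimum lost between [P] and [Q] can be lost
    first, and already next to its predecessor in [Q]. *)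
Lemma glue_facts P Q m : P \in NCdom n -> Q \in NCdom n -> refines P Q ->
  m \in nonmin Q -> m \notin nonmin P ->
  exists R, [/\ R \in NCdom n, refines P R, refines R Q, nonmin R = m |: nonmin P & blockpred R m = blockpred Q m].
Proof.
move=> NP NQ rPQ mQ mP; have PQ := refinesP NP NQ rPQ.
have [a [pdm am sam]] := blockpred_ex mQ.
have NR := glue_NC NP NQ rPQ mQ pdm sam am.
have RQ i j : same (glue P a m) i j -> same Q i j.
  case/same_glueP=> [/PQ //|[hi hj]].
  have h k : same P k a \/ same P k m -> same Q k m.
    by case=> /PQ // s; rewrite (same_left _ s).
  by rewrite (same_left _ (h _ hi)) same_sym h.
have PR i j := @same_glue_sub P a m i j.
exists (glue P a m); split=> //; try exact/refinesP.
  (* A newly lost minimum [k] lies in the glued block. In the block of [m] it is [m]; in that of [a]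
     it would be at most [a], and a smaller glued element would show that [k] or [m] is no minimum
     of [P]. *)
  apply/eqP; rewrite eqEsubset; apply/andP; split.
    apply/subsetP=> k /nonminP[i ik s]; rewrite in_setU1.
    apply/orP; case: (eqVneq k m) => [|km]; [by left|right].
    apply: contraNT km => kP.
    case/same_glueP: s => [s|[hi [hk|hk]]].
    - by case/negP: kP; apply/nonminP; exists i.
    - have ak : k <= a.
        by rewrite leqNgt; apply: contra kP => h; apply/nonminP; exists a; rewrite // same_sym.
      case: hi => [hi|hi]; first by case/negP: kP; apply/nonminP; exists i; rewrite // (same_right _ hk).
      by case/negP: mP; apply/nonminP; exists i; [lia | ].
    - by apply/eqP; apply: (min_uniq hk).
  by rewrite subUset sub1set (nonmin_sub PR) andbT; apply/nonminP; exists a => //; apply: same_glue_am.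
apply/eqP; rewrite eqn_leq blockpred_le_nonmin //= pdm; apply: blockpred_ge => //; exact: same_glue_am.
Qed.

End NCTheory.

(** * Covers of noncrossing partitions and their labels *)

Section NCCovers.
Variable n : nat.
Implicit Types (P Q x y z u v w : NCcarrier n) (i j k l a b c d m : 'I_n).
Implicit Types (s t : seq (NCcarrier n)) (p : 'I_n -> nat).
Local Notation D := (NCdom n).
Local Notation le := (@refines n).
Local Notation cov := (covers D le).
Local Notation lam := (@lamNC n).
Local Notation word := (word lam).

Lemma refines_same P Q i j : P \in D -> Q \in D -> le P Q -> same P i j -> same Q i j.
Proof. by move=> NP NQ /(refinesP NP NQ); apply. Qed.

Lemma refines_nonmin P Q : P \in D -> Q \in D -> le P Q -> nonmin P \subset nonmin Q.
Proof. by move=> NP NQ /(refinesP NP NQ)/nonmin_sub. Qed.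

Lemma refines_refl P : le P P.
Proof. by apply/forall_inP=> B BP; apply/exists_inP; exists B. Qed.

Lemma refines_trans : transitive le.
Proof.
move=> Q P R /forall_inP PQ /forall_inP QR; apply/forall_inP=> B /PQ/exists_inP[C /QR].
case/exists_inP=> E ER CE BC; apply/exists_inP; exists E => //; exact: subset_trans BC CE.
Qed.

Lemma refines_anti : {in D &, antisymmetric le}.
Proof.
move=> P Q NP NQ /andP[PQ QP]; apply: same_inj => // i j.
by apply/idP/idP; apply: refines_same.
Qed.

Lemma NCbot_partition : partition (NCbot n) [set: 'I_n].
Proof.
apply/and3P; split.
- by apply/eqP/setP=> k; rewrite inE; apply/bigcupP; exists [set k]; rewrite ?inE ?imset_f.
- apply/trivIsetP=> _ _ /imsetP[k _ ->] /imsetP[l _ ->] kl.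
  by rewrite disjoints1 inE; apply: contraNneq kl => ->.
- by apply/imsetP=> -[k _ /setP/(_ k)]; rewrite !inE eqxx.
Qed.

Lemma same_bot i j : same (NCbot n) i j = (i == j).
Proof.
rewrite sameE ?NCbot_partition //.
rewrite (def_pblock (partition_trivIset NCbot_partition) (imset_f _ _) (set11 i)) //.
by rewrite inE eq_sym.
Qed.

Lemma NCbot_dom : NCbot n \in D.
Proof.
apply: NC_intro; first exact: NCbot_partition.
by move=> i j k l ij jk _; rewrite !same_bot => /eqP e; move: ij jk; rewrite e; lia.
Qed.

Lemma refines_bot P : P \in D -> le (NCbot n) P.
Proof.
move=> NP; apply/refinesP; rewrite ?NCbot_dom // => i j.
by rewrite same_bot => /eqP->; apply: same_refl.
Qed.

Lemma nonmin_bot : nonmin (NCbot n) = set0.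
Proof.
apply/setP=> m; rewrite [RHS]inE; apply/nonminP=> -[a am]; rewrite same_bot => /eqP e.
by rewrite e ltnn in am.
Qed.

Lemma cov_intro P Q m : P \in D -> Q \in D -> le P Q -> m \notin nonmin P ->
  nonmin Q = m |: nonmin P -> cov P Q.
Proof.
move=> NP NQ PQ mP eQ; apply/and4P; split=> //.
  rewrite /Defs.ltP PQ andbT; apply: contraNneq mP => ->; rewrite eQ; exact: setU11.
apply/forall_inP=> z Nz; apply/negP=> /andP[/andP[Pz lPz] /andP[zQ lzQ]].
have [mz|mz] := boolP (m \in nonmin z).
  case/negP: zQ; apply/eqP/nonmin_eq => //.
  by rewrite eQ subUset sub1set mz refines_nonmin.
case/negP: Pz; apply/eqP/nonmin_eq => //; apply/subsetP=> k kz.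
have := subsetP (refines_nonmin Nz NQ lzQ) _ kz; rewrite eQ in_setU1 => /predU1P[e|//].
by rewrite -e kz in mz.
Qed.

(** [glue_facts] yields a partition strictly above [P] and below [Q] that loses a single minimum; in
    a cover it must be [Q]. *)
Lemma cov_elim P Q : cov P Q -> [/\ P \in D, Q \in D, le P Q &
  exists2 m, m \notin nonmin P & nonmin Q = m |: nonmin P].
Proof.
case/and4P=> NP NQ /andP[PQ lPQ] /forall_inP none; split=> //.
have : ~~ (nonmin Q \subset nonmin P) by apply: contraNN PQ => h; apply/eqP/nonmin_eq.
case/subsetPn=> m mQ mP; exists m => //.
have [R [NR lPR lRQ eR _]] := glue_facts NP NQ lPQ mQ mP.
have := none R NR; rewrite /Defs.ltP lPR lRQ !andbT negb_and !negbK => /orP[] /eqP e.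
  by rewrite e eR setU11 in mP.
by rewrite -e.
Qed.

Lemma cov_dom P Q : cov P Q -> P \in D /\ Q \in D.
Proof. by case/cov_elim. Qed.

Lemma cov_le P Q : cov P Q -> le P Q.
Proof. by case/cov_elim. Qed.

Lemma cov_nonmin P Q m : cov P Q -> m \in nonmin Q :\: nonmin P -> nonmin Q = m |: nonmin P.
Proof.
case/cov_elim=> _ _ _ [k kP eQ]; rewrite eQ => /setDP[/setU1P[->//|h]].
by rewrite h.
Qed.

Lemma cov_ex P Q : cov P Q -> exists m, m \in nonmin Q :\: nonmin P.
Proof. by case/cov_elim=> _ _ _ [m mP ->]; exists m; rewrite inE mP setU11. Qed.

Lemma cov_below P Q m i j : cov P Q -> m \in nonmin Q :\: nonmin P -> i < m -> j < m ->
  same Q i j -> same P i j.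
Proof.
move=> c mQ im jm s; have [NP NQ /(refinesP NP NQ) PQ _] := cov_elim c.
by apply: (merge_below PQ s) => k ki; rewrite (cov_nonmin c mQ) => /setU1P[e|//];
  move: ki; rewrite e leqNgt ?im ?jm.
Qed.

(** The label gives the predecessor [a] of [m], common to both covers. Every element is then linked
    in both to the same minimum: that of its own block of [P], or that of the block of [a] if its
    own minimum is [m]. *)
Lemma cov_inj P Q Q' m : cov P Q -> cov P Q' -> m \in nonmin Q :\: nonmin P ->
  m \in nonmin Q' :\: nonmin P -> blockpred Q m = blockpred Q' m -> Q = Q'.
Proof.
suff sub R R' : cov P R -> cov P R' -> m \in nonmin R :\: nonmin P ->
    m \in nonmin R' :\: nonmin P -> blockpred R m = blockpred R' m -> forall i j, same R i j -> same R' i j.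
  move=> c c' mQ mQ' e; apply: same_inj; try by case/cov_elim: c; case/cov_elim: c'.
  by move=> i j; apply/idP/idP; apply: sub.
move=> c c' mR mR' e i j s.
have [NP NR PR _] := cov_elim c; have [_ NR' PR' _] := cov_elim c'.
have [a [ea am sa]] := blockpred_ex (proj1 (setDP mR)).
have sa' : same R' a m.
  have [a' [ea' a'm sa']] := blockpred_ex (proj1 (setDP mR')).
  suff -> : a = a' by [].
  by apply/val_inj; move: ea' ea => /=; rewrite e => -> [].
have h k : exists2 r, same R' k r & same R k r && (r \notin nonmin R).
  have [r kr /andP[rk nr]] := min_ex P k; rewrite same_sym in kr.
  have [rR|rR] := boolP (r \in nonmin R); last first.
    by exists r; rewrite ?rR ?andbT; apply: refines_same kr.
  have {rR} rm : r = m.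
    by move: rR; rewrite (cov_nonmin c mR) => /setU1P[//|h]; rewrite h in nr.
  subst r; have [r ar /andP[ra nr']] := min_ex P a; rewrite same_sym in ar.
  exists r.
    by rewrite (same_left _ (refines_same NP NR' PR' kr)) -(same_left _ sa') (refines_same NP NR' PR' ar).
  rewrite (same_left _ (refines_same NP NR PR kr)) -(same_left _ sa) (refines_same NP NR PR ar) /=.
  by rewrite (cov_nonmin c mR) in_setU1 negb_or nr' andbT -val_eqE /= neq_ltn (leq_ltn_trans ra am).
have [r ir /andP[ir' nr]] := h i; have [r' jr /andP[jr' nr']] := h j.
have er : r = r' by apply: (min_uniq _ nr nr'); rewrite -(same_left _ ir') (same_left _ s).
by rewrite (same_left _ ir) er same_sym.
Qed.

Lemma minBE P i : partition P [set: 'I_n] -> exists m,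
  [/\ same P m i, m \notin nonmin P & minB (pblock P i) = m].
Proof.
move=> pP; have [m mi /andP[_ nonmin]] := min_ex P i; exists m; split=> //.
have mB : m \in pblock P i by rewrite -sameE // same_sym.
apply/eqP; rewrite eqn_leq; apply/andP; split.
  rewrite /minB; move: (mem_index_enum m); elim: (index_enum _) => // k r IHr.
  rewrite inE big_cons => /predU1P[<-|/IHr h]; first by rewrite mB geq_minl.
  by case: ifP => // _; rewrite geq_min h orbT.
apply: (big_ind (fun r => m <= r)); first exact/ltnW/ltn_ord.
  by move=> r r' h h'; rewrite leq_min h.
move=> k; rewrite -sameE // => ik; rewrite leqNgt; apply: contra nonmin => km.
by apply/nonminP; exists k => //; rewrite same_sym (same_left _ mi).
Qed.

(** Both sides are maxima over the same set: the merged blocks are those not in [Q], the larger of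
    their minima is the lost one [m], and below [m] the block of [Q] consists of elements of the
    other merged block. *)
Lemma lamNCE P Q m : cov P Q -> m \in nonmin Q :\: nonmin P -> lam P Q = blockpred Q m.
Proof.
move=> c mQP; have /setDP[mQ mP] := mQP.
have [NP NQ PQ _] := cov_elim c; have [pP pQ] := (NC_partition NP, NC_partition NQ).
apply: eq_bigl => a; apply/existsP/andP=> [[Bi /existsP[Bj]]|[am sa]].
  case/and5P=> /setDP[BiP BiQ] /setDP[BjP BjQ] ij aBi aj.
  have [i iBi eBi] := block_pblock pP BiP; have [j jBj eBj] := block_pblock pP BjP.
  have [mi [smi nmi emi]] := minBE i pP; have [mj [smj nmj emj]] := minBE j pP.
  (* A block of [P] missing from [Q] grows, so its [Q]-block contains two minima of [P]; one of them
     is lost, and only [m] is. *)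
  have aux k (B : {set 'I_n}) (r : 'I_n) : k \in B -> B = pblock P k -> B \in P -> B \notin Q ->
      same P r k -> r \notin nonmin P -> same Q r m.
    move=> kB eB BP BQ rk nr.
    have [h|/eqP h] := eqVneq (pblock P k) (pblock Q k).
      by rewrite eB h pblock_in in BQ.
    have /existsP[l] : [exists l, same Q k l && ~~ same P k l].
      apply: contra_notT h; rewrite negb_exists => /forallP h.
      apply/setP=> l; rewrite -!sameE //; apply/idP/idP; first exact: refines_same.
      by move=> kl; have := h l; rewrite kl negbK.
    case/andP=> Qkl; apply: contraNT => nrm.
    have nrQ : r \notin nonmin Q.
      rewrite (cov_nonmin c mQP) in_setU1 negb_or nr andbT.
      by apply: contraNneq nrm => ->; apply: same_refl.
    have [r' r'l /andP[_ nr']] := min_ex P l.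
    have Qrl : same Q r l by rewrite (same_left _ (refines_same NP NQ PQ rk)).
    have Qrr' : same Q r r' by rewrite (same_right _ (refines_same NP NQ PQ r'l)).
    rewrite -(same_left _ rk) -(same_right _ r'l).
    rewrite (min_uniq Qrr' nrQ) ?same_refl //.
    rewrite (cov_nonmin c mQP) in_setU1 negb_or nr' andbT.
    by apply: contraNneq nrm => <-.
  have Qi := aux _ _ _ iBi eBi BiP BiQ smi nmi.
  have Qj := aux _ _ _ jBj eBj BjP BjQ smj nmj.
  rewrite eBi eBj emi emj in ij aj.
  have ejm : mj = m.
    have : mj \in nonmin Q by apply/nonminP; exists mi; rewrite // (same_left _ Qi) same_sym.
    by rewrite (cov_nonmin c mQP) => /setU1P[//|h]; rewrite h in nmj.
  rewrite -ejm in Qi *; split=> //; rewrite -(same_left _ (_ : same Q mi a)) //.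
  apply: refines_same PQ _ => //; rewrite (same_left _ smi) sameE //.
  by rewrite -eBi.
have nPam : ~~ same P a m by apply: contra mP => s; apply/nonminP; exists a.
have notQ k : same Q a k -> pblock P k \notin Q.
  move=> ak; apply/negP=> h.
  have e : pblock P k = pblock Q k.
    by rewrite [RHS](def_pblock (partition_trivIset pQ) h) // -sameE ?same_refl.
  case/negP: nPam; rewrite -(@same_left n P k).
    by rewrite sameE // e -sameE // -(same_left _ ak).
  by rewrite sameE // e -sameE // same_sym.
have [mj [smj nmj emj]] := minBE m pP.
have e : mj = m by apply: min_uniq smj nmj mP.
have [mi [smi nmi emi]] := minBE a pP.
exists (pblock P a); apply/existsP; exists (pblock P m).
rewrite !in_setD !notQ ?same_refl // !pblock_in //= emj emi e am -sameE // same_refl /= andbT.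
rewrite (leq_ltn_trans _ am) // leqNgt; apply: contra nmi => ami.
by apply/nonminP; exists a; rewrite // same_sym.
Qed.

(** The steps of chains with attachment map [p], whose values are shifted like those of [blockpred].
    In a cover the quantifier ranges over the single lost minimum. *)
Definition ccov p : rel (NCcarrier n) := fun u v =>
  cov u v && [forall m in nonmin v :\: nonmin u, blockpred v m == p m].

Lemma ccov_cov p u v : ccov p u v -> cov u v.
Proof. by case/andP. Qed.

Lemma ccov_path p x s : path (ccov p) x s -> path cov x s.
Proof. exact: sub_path (@ccov_cov p) x s. Qed.

Lemma ccovE p u v m : ccov p u v -> m \in nonmin v :\: nonmin u -> blockpred v m = p m.
Proof. by case/andP=> _ /forall_inP h /h/eqP. Qed.

Lemma ccov_intro p u v m : cov u v -> m \in nonmin v :\: nonmin u -> blockpred v m = p m -> ccov p u v.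
Proof.
move=> c mv e; rewrite /ccov c; apply/forall_inP=> k.
rewrite (cov_nonmin c mv) => /setDP[/setU1P[->|h]]; first by rewrite e.
by rewrite h.
Qed.

Lemma path_last x s : x \in D -> path cov x s ->
  [/\ last x s \in D, le x (last x s) & nonmin x \subset nonmin (last x s)].
Proof.
elim: s x => [|z s IHs] x Nx /=; first by rewrite refines_refl.
case/andP=> c /(IHs z (proj2 (cov_dom c)))[Ny zy sy]; split=> //.
  exact: refines_trans (cov_le c) zy.
by apply: subset_trans sy; apply: refines_nonmin; [| case: (cov_dom c) | apply: cov_le].
Qed.

Lemma eq_ccov_path p p' x s : x \in D ->
  {in nonmin (last x s) :\: nonmin x, p =1 p'} -> path (ccov p) x s -> path (ccov p') x s.
Proof.
elim: s x => [|z s IHs] x Nx //= e /andP[c cs].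
have [_ Nz] := cov_dom (ccov_cov c); have [_ _ sub] := path_last Nz (ccov_path cs).
have sx := refines_nonmin Nx Nz (cov_le (ccov_cov c)).
apply/andP; split; last first.
  by apply: IHs => // k /setDP[ky kz]; apply: e; rewrite inE ky andbT; apply: contra kz; apply/subsetP.
have [m mz] := cov_ex (ccov_cov c); apply: (ccov_intro (ccov_cov c) mz).
rewrite (ccovE c mz); apply: e; have /setDP[h h'] := mz.
by rewrite inE h' (subsetP sub).
Qed.

Lemma ccov_ex x s : x \in D -> path cov x s -> exists p, path (ccov p) x s.
Proof.
elim: s x => [|z s IHs] x Nx /=; first by exists (fun=> 0).
case/andP=> c cs; have [_ Nz] := cov_dom c; have [p ps] := IHs z Nz cs.
have [m mz] := cov_ex c.
exists (fun i => if i == m then blockpred z m else p i); apply/andP; split.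
  by apply: (ccov_intro c mz); rewrite eqxx.
apply: eq_ccov_path ps => // k /setDP[_ kz].
by case: eqP => // e; rewrite e in kz; case/setDP: mz => h; rewrite h in kz.
Qed.

Lemma setD_step x z y m : nonmin z = m |: nonmin x -> m \notin nonmin x -> nonmin z \subset nonmin y ->
  m \in nonmin y :\: nonmin x /\ nonmin y :\: nonmin z = (nonmin y :\: nonmin x) :\ m.
Proof.
move=> ez mx /subsetP sub; split; first by rewrite inE mx sub // ez setU11.
by apply/setP=> k; rewrite in_setD1 !in_setD ez in_setU1 negb_or andbA.
Qed.

(** Each minimum is lost at exactly one step, which has label [p m]; the multiset of labels thus
    depends only on [p] and the two ends. *)
Lemma word_ccov p x s : x \in D -> path (ccov p) x s ->
  perm_eq (word x s) [seq p m | m <- enum (nonmin (last x s) :\: nonmin x)].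
Proof.
elim: s x => [|z s IHs] x Nx /=; first by rewrite setDv enum_set0.
case/andP=> c cs; have c' := ccov_cov c; have [_ Nz] := cov_dom c'.
have [m mz] := cov_ex c'; have /setDP[_ mx] := mz.
have [_ _ sub] := path_last Nz (ccov_path cs).
have [my e] := setD_step (cov_nonmin c' mz) mx sub.
rewrite (lamNCE c' mz) (ccovE c mz).
have h : perm_eq (enum (nonmin (last z s) :\: nonmin x)) (m :: enum (nonmin (last z s) :\: nonmin z)).
  apply: uniq_perm; rewrite /= ?enum_uniq ?andbT //.
    by rewrite mem_enum e in_setD1 eqxx.
  by move=> k; rewrite inE !mem_enum e in_setD1; case: eqP => // ->.
by rewrite perm_sym (permPl (perm_map p h)) /= perm_cons perm_sym; apply: IHs.
Qed.

(** The witness [w] is the partition reached by the step that loses [m]. *)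
Lemma step_at p x s m : x \in D -> path (ccov p) x s -> m \in nonmin (last x s) :\: nonmin x ->
  exists w, [/\ w \in D, le x w, le w (last x s), m \in nonmin w & blockpred w m = p m].
Proof.
elim: s x => [|z s IHs] x Nx /=; first by rewrite setDv inE.
case/andP=> c cs my; have c' := ccov_cov c; have [_ Nz] := cov_dom c'.
have [_ zy sub] := path_last Nz (ccov_path cs).
have [mz|mz] := boolP (m \in nonmin z).
  have mzx : m \in nonmin z :\: nonmin x by rewrite inE mz andbT; case/setDP: my.
  by exists z; split=> //; [apply: cov_le | apply: ccovE mzx].
have [|w [Nw zw wy mw e]] := IHs z Nz cs; first by rewrite inE mz; case/setDP: my.
by exists w; split=> //; apply: refines_trans zw; apply: cov_le.
Qed.

End NCCovers.

(** * Recovering chains from labels, and increasing chains *)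

Section NCLabels.
Variable n : nat.
Implicit Types (P Q x y z u v w : NCcarrier n) (i j k l a b c d m : 'I_n).
Implicit Types (s t : seq (NCcarrier n)) (p : 'I_n -> nat).
Local Notation D := (NCdom n).
Local Notation le := (@refines n).
Local Notation cov := (covers D le).
Local Notation lam := (@lamNC n).
Local Notation word := (word lam).

(** Because of the shift, [p m <= d] puts the left end of the arc of [m] strictly below [d]. After
    the later of the two losses, crossing arcs would force all four ends into one block, and the
    minimum just lost would have a larger predecessor than its label says. *)
Lemma ccov_arcs p x s d m : x \in D -> path (ccov p) x s ->
  d \in nonmin (last x s) :\: nonmin x -> m \in nonmin (last x s) :\: nonmin x ->
  p d < p m -> p m <= d -> d < m -> False.
Proof.
elim: s x => [|z s IHs] x Nx /=; first by rewrite setDv inE.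
case/andP=> c cs dD mD lt1 le2 lt3; have c' := ccov_cov c; have [_ Nz] := cov_dom c'.
have [_ _ sub] := path_last Nz (ccov_path cs).
have /setDP[dy dx] := dD; have /setDP[my mx] := mD.
have [dz|dz] := boolP (d \in nonmin z).
  have dzx : d \in nonmin z :\: nonmin x by rewrite in_setD dx.
  have [|w [Nw zw _ mw ew]] := @step_at n p z s m Nz cs.
    rewrite in_setD my andbT (cov_nonmin c' dzx) in_setU1 negb_or mx andbT.
    by rewrite -val_eqE neq_ltn lt3 orbT.
  have [b [eb bd sb]] := blockpred_ex dz; have [a [ea am sa]] := blockpred_ex mw.
  rewrite (ccovE c dzx) in eb; rewrite ew in ea; rewrite eb ea ltnS in lt1.
  rewrite ea in le2; have sbw := refines_same Nz Nw zw sb.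
  have sba := NC_noncrossing Nw lt1 le2 lt3 sbw sa.
  have := blockpred_ge lt3 (_ : same w d m); rewrite -(same_left _ sbw) (same_left _ sba) => /(_ sa).
  by rewrite ew ea ltnS leqNgt le2.
have [mz|mz] := boolP (m \in nonmin z).
  have mzx : m \in nonmin z :\: nonmin x by rewrite in_setD mx.
  have [|w [Nw zw _ dw ew]] := @step_at n p z s d Nz cs; first by rewrite in_setD dz.
  have [b [eb bd sb]] := blockpred_ex dw; have [a [ea am sa]] := blockpred_ex mz.
  rewrite (ccovE c mzx) in ea; rewrite ew in eb; rewrite eb ea ltnS in lt1.
  rewrite ea in le2; have saw := refines_same Nz Nw zw sa.
  have sba := NC_noncrossing Nw lt1 le2 lt3 sb saw.
  have := blockpred_ge le2 (_ : same w a d); rewrite -(same_left _ sba) => /(_ sb).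
  by rewrite ew eb ltnS leqNgt lt1.
by apply: (IHs z) lt1 le2 lt3; rewrite // in_setD ?dz ?mz.
Qed.

Lemma ccov_le p x s m : x \in D -> path (ccov p) x s ->
  m \in nonmin (last x s) :\: nonmin x -> p m <= m.
Proof. by move=> Nx cs /(step_at Nx cs)[w [_ _ _ _ <-]]; apply: blockpred_le. Qed.

(* A family of arcs [p m, m] without crossings is read off from the multiset of
   its left ends, as a parenthesization. *)
Lemma arcs_uniq (A : {set 'I_n}) p p' :
  (forall m, m \in A -> p' m <= m) -> (forall m, m \in A -> p m <= m) ->
  (forall d m, d \in A -> m \in A -> p d < p m -> p m <= d -> d < m -> False) ->
  (forall d m, d \in A -> m \in A -> p' d < p' m -> p' m <= d -> d < m -> False) ->
  perm_eq [seq p m | m <- enum A] [seq p' m | m <- enum A] -> {in A, p =1 p'}.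
Proof.
(* At the least disagreement [m], with [q m < q' m], the value [q' m] is taken less often by [q]
   than by [q']. An arc of [q] with this left end and right end beyond [m] would cross the arc of
   [m]; before [m] the maps agree, and [q'] takes the value once more at [m]. *)
have key q q' m : (forall m, m \in A -> q' m <= m) ->
    (forall d m, d \in A -> m \in A -> q d < q m -> q m <= d -> d < m -> False) ->
    perm_eq [seq q m | m <- enum A] [seq q' m | m <- enum A] -> m \in A ->
    (forall d, d \in A -> d < m -> q d = q' d) -> q m < q' m -> False.
  move=> le' arcs /permP/(_ (pred1 (q' m))) cnt mA agree lt.
  pose B := [set d in A | q d == q' m]; pose B' := [set d in A | q' d == q' m].
  have card (r : 'I_n -> nat) : count (pred1 (q' m)) [seq r i | i <- enum A] =
      #|[set d in A | r d == q' m]|.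
    rewrite count_map -size_filter cardE; apply/perm_size/uniq_perm.
    - by rewrite filter_uniq ?enum_uniq.
    - exact: enum_uniq.
    - by move=> k; rewrite mem_filter !mem_enum [RHS]inE andbC.
  rewrite !card -/B -/B' in cnt.
  suff /proper_card : B \proper B' by rewrite cnt ltnn.
  have noB d : d \in B -> d < m.
    rewrite inE => /andP[dA /eqP qd]; rewrite ltnNge leq_eqVlt; apply/negP=> /orP[|md].
      by move/eqP/val_inj=> e; move: lt; rewrite {1}e qd ltnn.
    by apply: (arcs m d) => //; rewrite qd //; apply: le'.
  apply/properP; split.
    apply/subsetP=> d dB; have := dB; rewrite !inE => /andP[dA /eqP <-].
    by rewrite dA -agree ?eqxx //; apply: noB.
  exists m; first by rewrite inE mA eqxx.
  by apply/negP=> /noB; rewrite ltnn.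
move=> le' le_ arcs arcs' pe m mA; apply/eqP; apply: contraT => bad.
have := @arg_minnP _ m (fun k => (k \in A) && (p k != p' k)) (fun k => k).
rewrite mA bad => /(_ isT)[k /andP[kA pk] mink].
have agree d : d \in A -> d < k -> p d = p' d.
  move=> dA dk; apply/eqP; apply: contraTT dk => blockpred; rewrite -leqNgt; apply: mink.
  by rewrite dA.
have [lt|lt|e] := ltngtP (p k) (p' k); last by rewrite e eqxx in pk.
  by case: (key p p' k).
by case: (key p' p k) => //; [rewrite perm_sym | move=> d dA dk; rewrite agree].
Qed.

(** Among minima with the same attachment the largest is lost first: if [m < k], then when [k] is
    lost [m] is already in that block, and the predecessor of [k] is at least [m]. *)
Lemma ccov_siblings p x z s m k : x \in D -> path (ccov p) x (z :: s) ->
  m \in nonmin z :\: nonmin x -> k \in nonmin (last z s) :\: nonmin x -> p k = p m -> k <= m.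
Proof.
move=> Nx /=/andP[c cs] mz /setDP[ky kx] e; rewrite leqNgt; apply/negP=> mk.
have c' := ccov_cov c; have [_ Nz] := cov_dom c'.
have [|w [Nw zw _ kw ew]] := @step_at n p z s k Nz cs.
  rewrite in_setD ky andbT (cov_nonmin c' mz) in_setU1 negb_or kx andbT.
  by rewrite -val_eqE neq_ltn mk orbT.
have [a [ea am sa]] := blockpred_ex (proj1 (setDP mz)); have [b [eb bk sb]] := blockpred_ex kw.
have eab : a = b.
  by apply/val_inj/eq_add_S; rewrite -ea -eb ew (ccovE c mz).
have := blockpred_ge mk (_ : same w m k); rewrite -(same_left _ (refines_same Nz Nw zw sa)) eab.
by move=> /(_ sb); rewrite eb ltnS -eab leqNgt am.
Qed.

(** The first label fixes [p m], and by [ccov_siblings] the first lost minimum is the largest one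
    with this value; [cov_inj] then gives the first step. *)
Lemma ccov_word_inj p x s t : x \in D -> path (ccov p) x s -> path (ccov p) x t ->
  last x s = last x t -> word x s = word x t -> s = t.
Proof.
elim: s t x => [|z s IHs] [|z' t] x Nx //= /andP[c cs] /andP[c' ct] el [ew1 ew].
have [_ Nz] := cov_dom (ccov_cov c); have [_ Nz'] := cov_dom (ccov_cov c').
have [m mz] := cov_ex (ccov_cov c); have [m' mz'] := cov_ex (ccov_cov c').
have epm : p m = p m'.
  by rewrite -(ccovE c mz) -(ccovE c' mz') -(lamNCE (ccov_cov c) mz) ew1 (lamNCE (ccov_cov c') mz').
have inD r q k : r \in D -> path (ccov p) r q -> k \in nonmin r :\: nonmin x -> k \in nonmin (last r q) :\: nonmin x.
  move=> Nr pr /setDP[kr kx]; have [_ _ /subsetP sub] := path_last Nr (ccov_path pr).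
  by rewrite in_setD kx sub.
have em : m = m'.
  apply/val_inj/eqP; rewrite /= eqn_leq; apply/andP; split.
    apply: (@ccov_siblings p x z' t) => //=; first by rewrite c'.
    by rewrite -el; apply: inD.
  apply: (@ccov_siblings p x z s) => //=; first by rewrite c.
  by rewrite el; apply: inD.
have ez : z = z'.
  apply: (cov_inj (ccov_cov c) (ccov_cov c') mz); rewrite em // -em (ccovE c mz) em.
  by rewrite (ccovE c' mz').
by rewrite -ez in ct el ew *; rewrite (IHs t z).
Qed.

Lemma word_inj x s t : x \in D -> path cov x s -> path cov x t ->
  last x s = last x t -> word x s = word x t -> s = t.
Proof.
move=> Nx cs ct el ew; have [p ps] := ccov_ex Nx cs; have [p' pt] := ccov_ex Nx ct.
apply: (@ccov_word_inj p x) => //; apply: eq_ccov_path (pt) => // k.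
rewrite -el; apply: arcs_uniq => {k}.
- by move=> m; apply: ccov_le.
- by move=> m; rewrite el; apply: ccov_le.
- by move=> d m; rewrite el; apply: ccov_arcs.
- by move=> d m; apply: ccov_arcs.
- have := word_ccov Nx pt; rewrite -el -ew => h; rewrite -(permPl h); exact: word_ccov.
Qed.

Lemma increasing_blockpred p x s : x \in D -> path (ccov p) x s -> increasing (word x s) ->
  forall m, m \in nonmin (last x s) :\: nonmin x -> p m = blockpred (last x s) m.
Proof.
elim: s x => [|z s IHs] x Nx /=; first by rewrite setDv => _ _ m; rewrite inE.
case/andP=> c cs inc; have c' := ccov_cov c; have [_ Nz] := cov_dom c'.
have [Ny zy sub] := path_last Nz (ccov_path cs).
have [k kz] := cov_ex c'; have ek := lamNCE c' kz.
have large : all (fun r => blockpred z k < r) (word z s).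
  by rewrite -ek; apply: order_path_min inc; apply: ltn_trans.
move=> m /setDP[my mx]; have [mz|mz] := boolP (m \in nonmin z); last first.
  by apply: IHs => //; [apply: path_sorted inc | rewrite in_setD mz].
have mzx : m \in nonmin z :\: nonmin x by rewrite in_setD mx.
have {ek kz} ekm : k = m.
  by move: kz; rewrite (cov_nonmin c' mzx) => /setDP[/setU1P[//|h]]; rewrite h.
subst k; rewrite -(ccovE c mzx); apply/eqP; rewrite eqn_leq.
rewrite (blockpred_le_nonmin _ (fun i j => @refines_same _ _ _ i j Nz Ny zy)) /=.
rewrite leqNgt; apply/negP=> lt.
have [a [ea am sa]] := blockpred_ex mz; have [e [ee em se]] := blockpred_ex my.
rewrite ea ee ltnS in lt.
(* Let [b] be the least final member of the block strictly between [a] and [m]. By noncrossing it is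
   still a minimum of [z], so it is lost later; by its choice its predecessor is then at most [a],
   and its label does not exceed that of [m]. *)
have := @arg_minnP _ e (fun b => [&& a < b, b < m & same (last z s) b m]) (fun b => b).
rewrite lt em se => /(_ isT)[b /and3P[ab bm sb] minb].
have sab : same (last z s) a b by rewrite (same_right _ sb); apply: refines_same sa.
have by_ : b \in nonmin (last z s) by apply/nonminP; exists a.
have notam d : same z d m -> d < m -> d <= a.
  by move=> sd dm; have := blockpred_ge dm sd; rewrite ea ltnS.
have nbz : b \notin nonmin z.
  apply/nonminP=> -[d db sd].
  have da : d <= a.
    rewrite leqNgt; apply/negP=> ad; have := minb d; rewrite ad (ltn_trans db bm).
    rewrite (same_left _ (refines_same Nz Ny zy sd)) sb => /(_ isT).
    by rewrite leqNgt db.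
  suff : same z b m by move/notam=> /(_ bm); rewrite leqNgt ab.
  move: da; rewrite leq_eqVlt => /orP[/eqP/val_inj e'|da].
    by rewrite -(same_left _ sd) e'.
  by rewrite -(same_left _ sd) (same_left _ (NC_noncrossing Nz da ab bm sd sa)).
have bD : b \in nonmin (last z s) :\: nonmin z by rewrite in_setD nbz.
have [w [Nw zw wy bw ew]] := step_at Nz cs bD.
have : p b \in word z s.
  rewrite (perm_mem (word_ccov Nz cs)); apply/mapP; exists b => //.
  by rewrite mem_enum.
move/(allP large); rewrite ea -ew; have [d [-> db sd]] := blockpred_ex bw.
rewrite ltnS => ad; have := minb d; rewrite ad (ltn_trans db bm).
rewrite (same_left _ (refines_same Nw Ny wy sd)) sb => /(_ isT).
by rewrite leqNgt db.
Qed.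

Lemma blockpred_inj P : {in nonmin P &, injective (blockpred P)}.
Proof.
move=> m k mP kP e; have [a [ea am sa]] := blockpred_ex mP; have [b [eb bk sb]] := blockpred_ex kP.
have eab : a = b by apply/val_inj/eq_add_S; rewrite -ea -eb.
subst b; have smk : same P m k by rewrite -(same_left _ sa).
apply/val_inj; case: (ltngtP m k) => // h.
  by have := blockpred_ge h smk; rewrite eb ltnS leqNgt am.
by have := blockpred_ge h (_ : same P k m); rewrite same_sym => /(_ smk); rewrite ea ltnS leqNgt bk.
Qed.

(** Lose the minima in the order of their predecessors in [y], each glued at once to this
    predecessor. The labels are distinct since an element precedes at most one other in its
    block. *)
Lemma increasing_ex x y : x \in D -> y \in D -> le x y ->
  exists s, [/\ path (ccov (blockpred y)) x s, last x s = y & increasing (word x s)].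
Proof.
have [r] := ubnP #|nonmin y :\: nonmin x|; elim: r x => // r IHr x lt Nx Ny xy.
have [D0|[m0 m0D]] := set_0Vmem (nonmin y :\: nonmin x).
  exists [::]; split=> //; apply: nonmin_eq => //.
  by rewrite -setD_eq0 D0.
have := @arg_minnP _ m0 (mem (nonmin y :\: nonmin x)) (blockpred y) m0D.
case=> m; rewrite inE => mD minm; have /setDP[my mx] := mD.
have [z [Nz xz zy ez epd]] := glue_facts Nx Ny xy my mx.
have c := cov_intro Nx Nz xz mx ez.
have mz : m \in nonmin z :\: nonmin x by rewrite in_setD mx ez setU11.
have [_ eD] := setD_step ez mx (refines_nonmin Nz Ny zy).
have [|//|//|//|s [cs ls inc]] := IHr z.
  by rewrite eD; move: lt; rewrite (cardsD1 m) mD.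
exists (z :: s); split=> //=; first by rewrite (ccov_intro c mz epd).
rewrite /increasing /= path_sortedE; last exact: ltn_trans.
rewrite -/(word z s) -/(increasing (word z s)) inc andbT; apply/allP=> q.
rewrite (perm_mem (word_ccov Nz cs)) => /mapP[k]; rewrite mem_enum ls eD.
case/setD1P=> km kD ->; rewrite /= (lamNCE c mz) epd ltn_neqAle minm // andbT.
have /setDP[ky _] := kD.
by apply: contraNneq km => e; apply/eqP/(blockpred_inj ky my).
Qed.

Lemma NC_ER : ER_labeling D le lam.
Proof.
move=> x y Nx Ny xy; have [s [cs ls inc]] := increasing_ex Nx Ny xy.
exists s; split; first by rewrite /maxchain (ccov_path cs) ls eqxx.
move=> t [/andP[ct /eqP lt] inct]; apply: (word_inj Nx (ccov_path cs) ct); first by rewrite ls lt.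
have [p pt] := ccov_ex Nx ct.
have {}pt : path (ccov (blockpred y)) x t.
  by apply: eq_ccov_path (pt) => // k kD; rewrite (increasing_blockpred Nx pt inct kD) lt.
apply: (irr_sorted_eq ltn_trans ltnn inc inct) => q.
by rewrite (perm_mem (word_ccov Nx cs)) (perm_mem (word_ccov Nx pt)) ls lt.
Qed.

End NCLabels.

(** * Quadratic exchanges of noncrossing chains *)

Section NCExchange.
Variable n : nat.
Implicit Types (P Q x y z u v w : NCcarrier n) (i j k l a b c d m : 'I_n).
Implicit Types (s t : seq (NCcarrier n)) (p : 'I_n -> nat).
Local Notation D := (NCdom n).
Local Notation le := (@refines n).
Local Notation cov := (covers D le).
Local Notation lam := (@lamNC n).
Local Notation word := (word lam).
Local Notation bot := (NCbot n).

Lemma ascent_blockpred x z w m : cov x z -> cov z w -> lam x z < lam z w ->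
  m \in nonmin z :\: nonmin x -> blockpred w m = blockpred z m.
Proof.
move=> cz cw lt mz; have [Nx Nz] := cov_dom cz; have [_ Nw] := cov_dom cw.
have [|p pzw] := @ccov_ex n x [:: z; w] Nx; first by rewrite /= cz cw.
have mw : m \in nonmin w :\: nonmin x.
  case/setDP: mz => h h'; rewrite in_setD h'.
  by rewrite (subsetP (refines_nonmin Nz Nw (cov_le cw))).
have <- := increasing_blockpred Nx pzw _ mw; last by rewrite /increasing /= lt.
by case/andP: pzw => c _; rewrite (ccovE c mz).
Qed.

Lemma exchange_nonmin x z z' w m k : cov x z -> cov z w -> cov x z' -> cov z' w ->
  lam x z < lam z w -> lam x z' = lam z w -> lam z' w = lam x z ->
  m \in nonmin z :\: nonmin x -> k \in nonmin w :\: nonmin z ->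
  k \in nonmin z' :\: nonmin x /\ m \in nonmin w :\: nonmin z'.
Proof.
move=> cz cw cz' cw' lt e e' mz kw; have [[_ Nz'] [_ Nw]] := (cov_dom cz', cov_dom cw).
have [h hz'] := cov_ex cz'; have [g gw] := cov_ex cw'.
have eq : g |: (h |: nonmin x) = k |: (m |: nonmin x).
  by rewrite -(cov_nonmin cz mz) -(cov_nonmin cw kw) -(cov_nonmin cz' hz') -(cov_nonmin cw' gw).
have [/setDP[_ mx] /setDP[_ hx]] := (mz, hz').
have mw : m \in nonmin w by rewrite (cov_nonmin cw kw) (cov_nonmin cz mz) !in_setU1 eqxx orbT.
case/setDP: kw => kw; rewrite (cov_nonmin cz mz) in_setU1 negb_or => /andP[km kx].
(* If [m] were lost first again, its label would be the larger of the two; but it is at most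
   [blockpred w m], which at an ascent is the smaller one. *)
have hm : h != m.
  apply: contraTneq (lt) => hm; subst h.
  rewrite -e (lamNCE cz mz) (lamNCE cz' hz') -leqNgt -(ascent_blockpred cz cw lt mz).
  exact: blockpred_le_nonmin (fun i j => refines_same Nz' Nw (cov_le cw')).
have hk : h = k.
  have : h \in k |: (m |: nonmin x) by rewrite -eq !in_setU1 eqxx orbT.
  by rewrite !in_setU1 (negPf hm) (negPf hx) !orbF => /eqP.
subst h; split=> //; rewrite in_setD mw andbT.
by rewrite (cov_nonmin cz' hz') in_setU1 negb_or eq_sym km mx.
Qed.

(** An exchange swaps both the order of the two lost minima and their labels, so each minimum keeps
    its attachment. *)
Lemma exchange_ccov p x z z' w : cov x z -> cov z w -> cov x z' -> cov z' w ->
  lam x z < lam z w -> lam x z' = lam z w -> lam z' w = lam x z ->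
  ccov p x z && ccov p z w = ccov p x z' && ccov p z' w.
Proof.
move=> cz cw cz' cw' lt e e'.
have [m mz] := cov_ex cz; have [k kw] := cov_ex cw.
have [kz' mw] := exchange_nonmin cz cw cz' cw' lt e e' mz kw.
have [[[ez ew] ez'] ew'] := (lamNCE cz mz, lamNCE cw kw, lamNCE cz' kz', lamNCE cw' mw).
apply/idP/idP=> /andP[c c']; apply/andP.
  split; [apply: ccov_intro cz' kz' _ | apply: ccov_intro cw' mw _].
    by rewrite -ez' e ew (ccovE c' kw).
  by rewrite -ew' e' ez (ccovE c mz).
split; [apply: ccov_intro cz mz _ | apply: ccov_intro cw kw _].
  by rewrite -ez -e' ew' (ccovE c' mw).
by rewrite -ew -e ez' (ccovE c kz').
Qed.

Lemma NC_switch x z w : cov x z -> cov z w -> lam x z < lam z w ->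
  exists! z', [/\ cov x z', cov z' w, lam x z' = lam z w & lam z' w = lam x z].
Proof.
move=> cz cw lt; have [Nx Nz] := cov_dom cz; have [_ Nw] := cov_dom cw.
have [m mz] := cov_ex cz; have [k kw] := cov_ex cw.
have [/setDP[_ mx] /setDP[kw' kz]] := (mz, kw).
move: (kz); rewrite (cov_nonmin cz mz) in_setU1 negb_or => /andP[km kx].
have xw : le x w by apply: refines_trans (cov_le cz) (cov_le cw).
(* The exchanged element loses [k] first, attached to its predecessor in [w]. *)
have [z' [Nz' xz' zw' ez' epd]] := glue_facts Nx Nw xw kw' kx.
have cz' : cov x z' by apply: cov_intro ez'.
have mz' : m \notin nonmin z' by rewrite ez' in_setU1 negb_or eq_sym km.
have ew : nonmin w = m |: nonmin z' by rewrite (cov_nonmin cw kw) (cov_nonmin cz mz) ez' setUCA.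
have cw' : cov z' w by apply: cov_intro ew.
have kz'x : k \in nonmin z' :\: nonmin x by rewrite in_setD kx ez' setU11.
have mwz' : m \in nonmin w :\: nonmin z' by rewrite in_setD mz' ew setU11.
have e : lam x z' = lam z w by rewrite (lamNCE cz' kz'x) epd (lamNCE cw kw).
exists z'; split.
  by split; rewrite // (lamNCE cw' mwz') (ascent_blockpred cz cw lt mz) (lamNCE cz mz).
move=> z'' [cz'' cw'' e1 e2].
have [kz'' _] := exchange_nonmin cz cw cz'' cw'' lt e1 e2 mz kw.
by apply: (cov_inj cz' cz'' kz'x kz''); rewrite -(lamNCE cz' kz'x) -(lamNCE cz'' kz'') e1.
Qed.

Lemma NC_EW : EW_labeling D le bot lam.
Proof.
split; [exact: NC_ER | | ].
  move=> q r x z w _ /cat_sorted2[_ /= /and3P[cz cw _]].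
  exact: NC_switch.
move=> x y s t /andP[cs /eqP ls] /andP[ct /eqP lt] e.
(* Nothing covers an [x] outside [D], so only the empty chain starts there. *)
have [Nx|Nx] := boolP (x \in D); first by apply: word_inj e; rewrite ?ls.
case: s cs ls e => [|z s] /=; first by case: t ct lt.
by case/andP=> /cov_dom[h]; rewrite h in Nx.
Qed.

(* A path of [qstep]s between two chains may pass through sets that are not
   chains; what is preserved along it is that every element of the set lies on
   a chain with attachment map [p]. *)
Definition on_chain p y z :=
  (exists2 s, path (ccov p) bot s & last bot s = z) /\
  (exists2 s, path (ccov p) z s & last z s = y).

(* The left chain provides [p m ~ m] in [v]; a later element of that block
   below [m] would still lie between [p m] and [m] when the right chain removes [m]. *)
Lemma on_chain_ccov p y u v : on_chain p y u -> on_chain p y v -> cov u v -> ccov p u v.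
Proof.
move=> [_ [t ct lt]] [[s cs ls] [t' ct' lt']] c; have [Nu Nv] := cov_dom c.
have [m mv] := cov_ex c; have /setDP[mv' mu] := mv.
have [_ _ /subsetP sub] := path_last Nv (ccov_path ct').
apply: (ccov_intro c mv).
have [|w [Nw _ wv mw ew]] := @step_at n p bot s m (NCbot_dom n) cs.
  by rewrite nonmin_bot setD0 ls.
have [|w' [Nw' uw' _ mw' ew']] := @step_at n p u t m Nu ct.
  by rewrite in_setD mu lt -lt' sub.
rewrite ls in wv; apply/eqP; rewrite eqn_leq andbC -ew.
rewrite (blockpred_le_nonmin _ (fun i j => @refines_same _ _ _ i j Nw Nv wv)) /= leqNgt ew; apply/negP=> lt1.
have [a [ea am sa]] := blockpred_ex mv'.
have [b [eb bm sb]] := blockpred_ex mw'; rewrite ew' in eb.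
have [b' [eb' bm' sb']] := blockpred_ex mw; rewrite ew eb in eb'.
have ebb : b = b' by apply/val_inj/eq_add_S.
subst b'; have sab : same u a b.
  by apply: (cov_below c mv) => //; rewrite (same_left _ sa) same_sym; apply: refines_same sb'.
have := blockpred_ge am (_ : same w' a m); rewrite (same_left _ (refines_same Nu Nw' uw' sab)).
by move=> /(_ sb); rewrite ew' ltnNge -ltnS -ea; rewrite lt1.
Qed.

Lemma on_chain_mid p y x z w : on_chain p y x -> on_chain p y w ->
  ccov p x z && ccov p z w -> on_chain p y z.
Proof.
move=> [[s cs ls] _] [_ [t ct lt]] /andP[cz cw]; split.
  by exists (rcons s z); rewrite ?last_rcons // rcons_path cs ls.
by exists (w :: t) => //=; rewrite cw.
Qed.

Lemma qstep_on_chain p y (c d : {set NCcarrier n}) : qstep D le lam c d ->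
  (forall z, z \in c -> on_chain p y z) -> forall z, z \in d -> on_chain p y z.
Proof.
case/orP=> /existsP[x /existsP[z /existsP[w /existsP[z']]]].
  case/and5P=> xc zc wc cz /and5P[cw cz' cw' lt /and3P[/eqP e /eqP e' /eqP->]] on v.
  case/setU1P=> [->|/setD1P[_ /on //]].
  apply: (on_chain_mid (on _ xc) (on _ wc)).
  by rewrite -(exchange_ccov p cz cw cz' cw' lt e e') !(on_chain_ccov (y := y)) //; apply: on.
case/and5P=> xc zc wc cz /and5P[cw cz' cw' lt /and3P[/eqP e /eqP e' /eqP dE]] on v vd.
(* Backwards, the ends [x] and [w] differ from the replaced element and so belong to [c] as well;
   only [z] has to be put on a chain. *)
have ne u u' : cov u u' -> u != u' by case/and4P=> _ _ /andP[].
have xc' : x \in c by rewrite dE !inE xc (ne _ _ cz) orbT.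
have wc' : w \in c by rewrite dE !inE wc [w == z]eq_sym (ne _ _ cw) orbT.
have [->|vz] := eqVneq v z; last by apply: on; rewrite dE !inE vz vd orbT.
apply: (on_chain_mid (on _ xc') (on _ wc')).
rewrite (exchange_ccov p cz cw cz' cw' lt e e') !(on_chain_ccov (y := y)) //; apply: on => //;
  by rewrite dE setU11.
Qed.

Lemma connect_qstep_word s t : path cov bot s -> path cov bot t ->
  last bot s = last bot t ->
  connect (qstep D le lam) [set z in bot :: s] [set z in bot :: t] ->
  perm_eq (word bot s) (word bot t).
Proof.
move=> cs ct el; have [p ps] := ccov_ex (NCbot_dom n) cs => conn.
have on : forall z, z \in [set z in bot :: t] -> on_chain p (last bot s) z.
  have {ct el} on z : z \in [set z in bot :: s] -> on_chain p (last bot s) z.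
    rewrite in_set => zs; case/splitPl: zs ps => s1 s2 e.
    by rewrite cat_path last_cat e => /andP[p1 p2]; split; [exists s1 | exists s2].
  case/connectP: conn => q; elim: q {s cs ps} [set z in bot :: s] (last bot s) on => [|d q IHq] c y on /=.
    by move=> _ ->.
  by case/andP=> cd pq e; apply: (IHq d) => //; apply: qstep_on_chain on.
(* Consecutive elements of [t] lie on chains with map [p] and form covers, so [t] itself has
   attachment map [p], and [word_ccov] compares the words. *)
have pt : path (ccov p) bot t.
  have {}on z : z \in bot :: t -> on_chain p (last bot s) z by move=> h; apply: on; rewrite in_set.
  move: (last bot s) on => {el conn} y on; elim: t (bot) on ct => [|z t IHt] x on //= /andP[c ct].
  rewrite (on_chain_ccov (on x _) (on z _)) ?inE ?eqxx ?orbT //=.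
  by apply: IHt ct => v vt; apply: on; rewrite inE vt orbT.
rewrite (permPl (word_ccov (NCbot_dom n) ps)) el perm_sym.
exact: word_ccov (NCbot_dom n) pt.
Qed.

End NCExchange.

Theorem theorem5p6 (n : nat) : 1 <= n ->
  EW_labeling (NCdom n) (@refines n) (NCbot n) (@lamNC n) /\
  whitney_dual (NCdom n) (@refines n) (NCbot n)
    (Qdom (NCdom n) (@refines n) (NCbot n) (@lamNC n))
    (Qle (NCdom n) (@refines n) (NCbot n) (@lamNC n))
    (Qbot (NCdom n) (@refines n) (NCbot n) (@lamNC n)).
Proof.
move=> _; split; first exact: NC_EW.
apply: (@EW_whitney_dual _ _ _ _ (fun P => #|nonmin P|)).
- exact: NCbot_dom.
- exact: refines_bot.
- exact: refines_refl.
- exact: refines_trans.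
- exact: refines_anti.
- by rewrite nonmin_bot cards0.
- move=> P R c; have [m mR] := cov_ex c.
  by rewrite (cov_nonmin c mR) cardsU1; case/setDP: mR => _ ->.
- exact: NC_EW.
- exact: connect_qstep_word.
Qed.
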